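(* In the logic $\mathcal{G}$ described below, the rules $\unrhd\mathcal{L}$ and $\unrhd\mathcal{L}_{\mathit{CSNAS}}$ are inter-admissible: any instance of either rule can be replaced, given derivations of its premises, by a derivation of its conclusion using the other rule (so replacing $\unrhd\mathcal{L}$ by $\unrhd\mathcal{L}_{\mathit{CSNAS}}$ does not change the set of provable sequents). Here $\unrhd\mathcal{L}_{\mathit{CSNAS}}$ is the rule: from the premises $\{\Sigma\theta : \Gamma\langle\theta\rangle \vdash C\langle\theta\rangle \mid \theta\in \mathit{CSNAS}(\Sigma,s,t)\}$ infer $\Sigma : \Gamma, s\unrhd t \vdash C$, where $\mathit{CSNAS}(\Sigma,s,t)$ is any complete set of nominal abstraction solutions of $s$ and $t$ on $\Sigma$.
   Context: THE LOGIC $\mathcal{G}$. Terms are simply typed (Church) $\lambda$-terms over constants and variables, identified up to $\alpha\beta\eta$-conversion. There is a type $o$ of formulas; $o$ does not occur in argument types of non-logical constants nor in types of eigenvariables. Logical constants: $\top,\bot,\land,\lor,\supset$, and for each type $\tau$ not containing $o$, $\forall_\tau,\exists_\tau,\nabla_\tau$ of type $(\tau\to o)\to o$ (written $\forall x.B$ for $\forall(\lambda x.B)$, etc.). Constants are partitioned into nominal constants $\mathcal{C}$ (infinitely many at each type at which $\nabla$ is allowed) and ordinary constants $\mathcal{K}$. $\mathrm{supp}(t)$ is the set of nominal constants in $t$. A permutation $\pi$ is a type-preserving bijection of $\mathcal{C}$ moving finitely many elements, acting on terms by renaming nominal constants; $B\approx B'$ iff $B$ $\lambda$-converts to $\pi.B'$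 for some $\pi$. Substitutions: type-preserving maps from variables to terms, identity almost everywhere; $\mathrm{supp}(\theta)$ = nominal constants in the range; $\theta\uparrow\Sigma$ is $\theta$ restricted to the variables in $\Sigma$ (identity elsewhere). $B[\theta]$ is ordinary capture-avoiding application; $B\langle\theta\rangle=(\pi.B)[\theta]$ for a permutation $\pi$ sending $\mathrm{supp}(B)$ outside $\mathrm{supp}(\theta)$; on multisets, $\Gamma\langle\theta\rangle=\{B\langle\theta\rangle\mid B\in\Gamma\}$. For a signature $\Sigma$ (set of variables), $\Sigma\theta$ is $\Sigma$ with the domain variables of $\theta$ removed and all free variables of the range terms added. $\pi.\theta$ replaces each $t/x$ in $\theta$ by $(\pi.t)/x$; $\theta\circ\rho$ is ordinary composition ($B[\theta\circ\rho]=B[\theta][\rho]$); $\theta\bullet\rho=(\pi.\theta)\circ\rho$ for a permutation $\pi$ with $\mathrm{supp}(\pi.\theta)\cap\mathrm{supp}(\rho)=\emptyset$. $\theta\approx\rho$ iff $\theta=\pi.\rho$ for some $\pi$. $\rho\le\theta$ iff $\rho\approx\theta\bullet\sigma$ for some $\sigma$; $\rho\le_\Sigma\theta$ iff $\rho\uparrow\Sigma\le\theta\uparrow\Sigma$. Nominal abstraction: for $s:\tau_1\to\cdots\to\tau_n\to\tau$ and $t:\tau$, $s\unrhd t$ is a formula; ''$s\unrhd t$ holds'' iff $s$ $\lambda$-converts to $\lambda c_1\dots\lambda c_n.t$ (the $c_i$ distinct nominal constants abstracted out of $t$ by replacing them with fresh bound variables). $\theta$ is a solution to $s\unrhd t$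 iff $(s\unrhd t)\langle\theta\rangle$ holds. A complete set of nominal abstraction solutions of $s$ and $t$ on $\Sigma$ is a set $S$ of substitutions such that every $\theta\in S$ is a solution to $s\unrhd t$, and for every solution $\rho$ there is $\theta\in S$ with $\rho\le_\Sigma\theta$. Definitions: a fixed finite set of clauses $\forall\vec x.\,p\,\vec x \triangleq B\,p\,\vec x$ (or with $\stackrel{\mu}{=}$ inductive, or $\stackrel{\nu}{=}$ co-inductive), at most one per predicate constant $p$, where $B$ contains no $p$, no $\vec x$ and no nominal constants; stratified: there are levels $\mathrm{lvl}(p)\in\mathbb{N}$, extended to $\lambda$-normal formulas by $\mathrm{lvl}(p\,\vec t)=\mathrm{lvl}(p)$, $\mathrm{lvl}(\top)=\mathrm{lvl}(\bot)=\mathrm{lvl}(s\unrhd t)=0$, $\mathrm{lvl}(B\land C)=\mathrm{lvl}(B\lor C)=\max$, $\mathrm{lvl}(B\supset C)=\max(\mathrm{lvl}(B)+1,\mathrm{lvl}(C))$, quantifiers transparent, with $\mathrm{lvl}(B\,(\lambda\vec x.\top)\,\vec x)<\mathrm{lvl}(p)$ for every clause. Sequents $\Sigma:\Gamma\vdash C$: $\Sigma$ a set of eigenvariables containing the free variables of $\Gamma,C$; $\Gamma$ a multiset. Rules: id: $\Sigma:\Gamma,B\vdash B'$ if $B\approx B'$. cut: from $\Sigma:\Gamma\vdash B$ and $\Sigma:B,\Delta\vdash C$ infer $\Sigma:\Gamma,\Delta\vdash C$. $c\mathcal{L}$: from $\Sigma:\Gamma,B,B\vdash C$ infer $\Sigma:\Gamma,B\vdash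 C$. $\bot\mathcal{L}$: $\Sigma:\Gamma,\bot\vdash C$. $\top\mathcal{R}$: $\Sigma:\Gamma\vdash\top$. $\lor\mathcal{L}$: from $\Sigma:\Gamma,B\vdash C$ and $\Sigma:\Gamma,D\vdash C$ infer $\Sigma:\Gamma,B\lor D\vdash C$. $\lor\mathcal{R}$: from $\Sigma:\Gamma\vdash B_i$ infer $\Sigma:\Gamma\vdash B_1\lor B_2$. $\land\mathcal{L}$: from $\Sigma:\Gamma,B_i\vdash C$ infer $\Sigma:\Gamma,B_1\land B_2\vdash C$. $\land\mathcal{R}$: from $\Sigma:\Gamma\vdash B$ and $\Sigma:\Gamma\vdash C$ infer $\Sigma:\Gamma\vdash B\land C$. $\supset\mathcal{L}$: from $\Sigma:\Gamma\vdash B$ and $\Sigma:\Gamma,D\vdash C$ infer $\Sigma:\Gamma,B\supset D\vdash C$. $\supset\mathcal{R}$: from $\Sigma:\Gamma,B\vdash C$ infer $\Sigma:\Gamma\vdash B\supset C$. $\forall\mathcal{L}$ / $\exists\mathcal{R}$: from $\Sigma:\Gamma,B[t/x]\vdash C$ (resp. $\Sigma:\Gamma\vdash B[t/x]$) infer $\Sigma:\Gamma,\forall_\tau x.B\vdash C$ (resp. $\Sigma:\Gamma\vdash\exists_\tau x.B$), where $t$ is a well-typed term of type $\tau$ built from $\Sigma$ and $\mathcal{K}\cup\mathcal{C}$. $\forall\mathcal{R}$ / $\exists\mathcal{L}$: from $\Sigma,h:\Gamma\vdash B[h\,\vec c/x]$ (resp. $\Sigma,h:\Gamma,B[h\,\vec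 c/x]\vdash C$) infer $\Sigma:\Gamma\vdash\forall x.B$ (resp. $\Sigma:\Gamma,\exists x.B\vdash C$), where $h\notin\Sigma$ is a fresh variable of suitable type and $\vec c$ lists $\mathrm{supp}(B)$. $\nabla\mathcal{L}$ / $\nabla\mathcal{R}$: from $\Sigma:\Gamma,B[a/x]\vdash C$ (resp. $\Sigma:\Gamma\vdash B[a/x]$) infer $\Sigma:\Gamma,\nabla x.B\vdash C$ (resp. $\Sigma:\Gamma\vdash\nabla x.B$), $a$ a nominal constant not in $\mathrm{supp}(B)$. $\unrhd\mathcal{L}$: from the (possibly infinite) family $\{\Sigma\theta:\Gamma\langle\theta\rangle\vdash C\langle\theta\rangle\mid\theta$ a solution to $s\unrhd t\}$ infer $\Sigma:\Gamma,s\unrhd t\vdash C$. $\unrhd\mathcal{R}$: $\Sigma:\Gamma\vdash s\unrhd t$ provided $s\unrhd t$ holds. $\mathit{def}\mathcal{L}$ / $\mathit{def}\mathcal{R}$ (for $p$ with clause body $B$ of any of the three kinds): from $\Sigma:\Gamma,B\,p\,\vec t\vdash C$ infer $\Sigma:\Gamma,p\,\vec t\vdash C$; from $\Sigma:\Gamma\vdash B\,p\,\vec t$ infer $\Sigma:\Gamma\vdash p\,\vec t$. $\mathcal{IL}$: if $p$ has clause $\forall\vec x.p\,\vec x\stackrel{\mu}{=}B\,p\,\vec x$ and $S$ is a term of the type of $p$ without nominal constants, from $\vec x:B\,S\,\vec x\vdash S\,\vec x$ and $\Sigma:\Gamma,S\,\vec t\vdash C$ infer $\Sigma:\Gamma,p\,\vec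 t\vdash C$. $\mathcal{CIR}$: if $p$ has clause $\forall\vec x.p\,\vec x\stackrel{\nu}{=}B\,p\,\vec x$ and $S$ as before, from $\Sigma:\Gamma\vdash S\,\vec t$ and $\vec x:S\,\vec x\vdash B\,S\,\vec x$ infer $\Sigma:\Gamma\vdash p\,\vec t$. Derivations are well-founded, possibly infinitely branching trees of rule instances. *)

(* Defs.v *)
From Stdlib Require Import List Permutation ClassicalEpsilon.
Import ListNotations.

Set Implicit Arguments.
Unset Strict Implicit.
Unset Printing Implicit Defensive.

(** * Types *)

Inductive ty (base : Type) : Type :=
| O : ty base
| Base : base -> ty base
| Arr : ty base -> ty base -> ty base.

Arguments O {base}.

Fixpoint ofree {base : Type} (a : ty base) : bool :=
  match a with
  | O => false
  | Base _ => true
  | Arr a b => ofree a && ofree b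
  end.

(** Types in which [O] does not occur: the types of eigenvariables, of nominal
    constants, of quantified variables and of arguments of non-logical
    constants. *)
Record oty (base : Type) : Type := OTy {
  oty_ty :> ty base;
  oty_ofree : ofree oty_ty = true
}.

Definition arrows {base : Type} (l : list (ty base)) (b : ty base) : ty base :=
  fold_right (@Arr base) b l.

Definition tys {base : Type} (l : list (oty base)) : list (ty base) :=
  map (@oty_ty base) l.

Lemma ofree_arrows (base : Type) (l : list (oty base)) (b : oty base) :
  ofree (arrows (tys l) b) = true.
Proof.
  induction l as [|a l IH]; simpl; [apply oty_ofree|].
  rewrite (oty_ofree a); exact IH.
Qed.

Definition oarrows {base : Type} (l : list (oty base)) (b : oty base) : oty base :=
  OTy (ofree_arrows l b).

(** * Non-logical vocabulary *)

(** The ordinary non-logical constants, split according to the target of their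
    type: an [f : fsym] has type [fargs f -> Base (ftarget f)] and a predicate
    constant [p : psym] has type [pargs p -> O]. *)
Record signature : Type := Signature {
  base : Type;
  fsym : Type;
  fargs : fsym -> list (oty base);
  ftarget : fsym -> base;
  psym : Type;
  pargs : psym -> list (oty base)
}.

Section Terms.

Variable sg : signature.

Local Notation ty := (ty (base sg)).
Local Notation oty := (oty (base sg)).

(** Eigenvariables and nominal constants: countably many of each at each
    [O]-free type. *)
Definition var : Type := (oty * nat)%type.
Definition nom : Type := (oty * nat)%type.

(** * Terms *)

Inductive logic : ty -> Type :=
| LTop : logic O
| LBot : logic O
| LAnd : logic (Arr O (Arr O O))
| LOr : logic (Arr O (Arr O O))
| LImp : logic (Arr O (Arr O O))
| LAll (a : oty) : logic (Arr (Arr a O) O)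
| LEx (a : oty) : logic (Arr (Arr a O) O)
| LNabla (a : oty) : logic (Arr (Arr a O) O)
| LNabs (l : list ty) (b : ty) : logic (Arr (arrows l b) (Arr b O)).

Inductive mem : list ty -> ty -> Type :=
| here G a : mem (a :: G) a
| there G a b : mem G a -> mem (b :: G) a.

(** [tm G a]: terms of type [a] whose bound variables are de Bruijn indices
    into [G]; eigenvariables and nominal constants are named. *)
Inductive tm : list ty -> ty -> Type :=
| TBound G a : mem G a -> tm G a
| TVar G (a : oty) (n : nat) : tm G a
| TNom G (a : oty) (n : nat) : tm G a
| TFun G (f : fsym sg) : tm G (arrows (tys (fargs f)) (Base (ftarget f)))
| TPred G (p : psym sg) : tm G (arrows (tys (pargs p)) O)
| TLog G a : logic a -> tm G a
| TApp G a b : tm G (Arr a b) -> tm G a -> tm G b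
| TLam G a b : tm (a :: G) b -> tm G (Arr a b).

Arguments TVar {G}.
Arguments TNom {G}.
Arguments TFun {G}.
Arguments TPred {G}.

Definition form : Type := tm [] O.

Definition ren (G D : list ty) : Type := forall a, mem G a -> mem D a.

Definition up_ren G D b (r : ren G D) : ren (b :: G) (b :: D) :=
  fun a m =>
    match m in mem G' a' return
      match G' with [] => unit | c :: G0 => ren G0 D -> mem (c :: D) a' end
    with
    | here _ _ => fun _ => here _ _
    | there _ m' => fun r => there _ (r _ m')
    end r.

Fixpoint rename G a (t : tm G a) : forall D, ren G D -> tm D a :=
  match t in tm G a return forall D, ren G D -> tm D a with
  | TBound m => fun D r => TBound (r _ m)
  | TVar a n => fun D r => TVar a n
  | TNom a n => fun D r => TNom a n
  | TFun f => fun D r => TFun f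
  | TPred p => fun D r => TPred p
  | TLog _ l => fun D r => TLog D l
  | TApp t u => fun D r => TApp (rename t r) (rename u r)
  | TLam t => fun D r => TLam (rename t (up_ren r))
  end.

Definition shift G a b (t : tm G a) : tm (b :: G) a :=
  rename t (fun c m => there b m).

Definition wk0 G a (t : tm [] a) : tm G a :=
  rename t (fun c m => match m in mem G' _ return
                         match G' with [] => mem G c | _ => unit end
                       with here _ _ => tt | there _ _ => tt end).

Definition bsub (G D : list ty) : Type := forall a, mem G a -> tm D a.

Definition up_bsub G D b (s : bsub G D) : bsub (b :: G) (b :: D) :=
  fun a m =>
    match m in mem G' a' return
      match G' with [] => unit | c :: G0 => bsub G0 D -> tm (c :: D) a' end
    with
    | here _ _ => fun _ => TBound (here _ _)
    | there _ m' => fun s => shift _ (s _ m')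
    end s.

Fixpoint bsubst G a (t : tm G a) : forall D, bsub G D -> tm D a :=
  match t in tm G a return forall D, bsub G D -> tm D a with
  | TBound m => fun D s => s _ m
  | TVar a n => fun D s => TVar a n
  | TNom a n => fun D s => TNom a n
  | TFun f => fun D s => TFun f
  | TPred p => fun D s => TPred p
  | TLog _ l => fun D s => TLog D l
  | TApp t u => fun D s => TApp (bsubst t s) (bsubst u s)
  | TLam t => fun D s => TLam (bsubst t (up_bsub s))
  end.

(** [inst B t] is B[t/x], for x the outermost bound variable. *)
Definition inst G a b (t : tm (a :: G) b) (u : tm G a) : tm G b :=
  bsubst t (fun c m =>
    match m in mem G' c' return
      match G' with [] => unit | a' :: G0 => tm G0 a' -> tm G0 c' end
    with
    | here _ _ => fun u => u
    | there _ m' => fun _ => TBound m'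
    end u).

(** Terms are identified up to [conv]: alpha is built into the de Bruijn
    representation, and everything below is stated up to [conv]. *)
Inductive conv : forall G a, tm G a -> tm G a -> Prop :=
| conv_refl G a (t : tm G a) : conv t t
| conv_sym G a (t u : tm G a) : conv t u -> conv u t
| conv_trans G a (t u v : tm G a) : conv t u -> conv u v -> conv t v
| conv_app G a b (t t' : tm G (Arr a b)) (u u' : tm G a) :
    conv t t' -> conv u u' -> conv (TApp t u) (TApp t' u')
| conv_lam G a b (t t' : tm (a :: G) b) : conv t t' -> conv (TLam t) (TLam t')
| conv_beta G a b (t : tm (a :: G) b) (u : tm G a) :
    conv (TApp (TLam t) u) (inst t u)
| conv_eta G a b (t : tm G (Arr a b)) :
    conv (TLam (TApp (shift a t) (TBound (here G a)))) t.

Fixpoint args (G : list ty) (l : list ty) : Type :=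
  match l with
  | [] => unit
  | a :: l => (tm G a * args G l)%type
  end.

Fixpoint apps G (l : list ty) b : tm G (arrows l b) -> args G l -> tm G b :=
  match l return tm G (arrows l b) -> args G l -> tm G b with
  | [] => fun t _ => t
  | a :: l => fun t us => apps (TApp t (fst us)) (snd us)
  end.

Fixpoint nom_args G (cs : list nom) : args G (tys (map fst cs)) :=
  match cs return args G (tys (map fst cs)) with
  | [] => tt
  | c :: cs => (TNom (fst c) (snd c), nom_args G cs)
  end.

(** [var_args l xs ts]: [xs] is a list of variables of types [l] and [ts] is
    the same list, as an argument list. *)
Inductive var_args : forall l : list oty, list var -> args [] (tys l) -> Prop :=
| var_args_nil : @var_args [] [] tt
| var_args_cons (a : oty) (n : nat) l xs ts :
    @var_args l xs ts -> @var_args (a :: l) ((a, n) :: xs) (TVar a n, ts).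

(** * Formulas *)

Definition top G : tm G O := TLog G LTop.
Definition bot G : tm G O := TLog G LBot.
Definition conj G (B C : tm G O) : tm G O := TApp (TApp (TLog G LAnd) B) C.
Definition disj G (B C : tm G O) : tm G O := TApp (TApp (TLog G LOr) B) C.
Definition imp G (B C : tm G O) : tm G O := TApp (TApp (TLog G LImp) B) C.
Definition all G (a : oty) (B : tm (oty_ty a :: G) O) : tm G O :=
  TApp (TLog G (LAll a)) (TLam B).
Definition ex G (a : oty) (B : tm (oty_ty a :: G) O) : tm G O :=
  TApp (TLog G (LEx a)) (TLam B).
Definition nabla G (a : oty) (B : tm (oty_ty a :: G) O) : tm G O :=
  TApp (TLog G (LNabla a)) (TLam B).
Definition nabs G (l : list ty) (b : ty) (s : tm G (arrows l b)) (t : tm G b) :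
  tm G O := TApp (TApp (TLog G (LNabs l b)) s) t.
Definition atom G (p : psym sg) (ts : args G (tys (pargs p))) : tm G O :=
  apps (TPred p) ts.

(** * Occurrences and support *)

Fixpoint occurs_nom (c : nom) G a (t : tm G a) : Prop :=
  match t with
  | TNom a n => c = (a, n)
  | TApp t u => occurs_nom c t \/ occurs_nom c u
  | TLam t => occurs_nom c t
  | _ => False
  end.

Fixpoint occurs_var (x : var) G a (t : tm G a) : Prop :=
  match t with
  | TVar a n => x = (a, n)
  | TApp t u => occurs_var x t \/ occurs_var x u
  | TLam t => occurs_var x t
  | _ => False
  end.

Fixpoint occurs_pred (p : psym sg) G a (t : tm G a) : Prop :=
  match t with
  | TPred q => p = q
  | TApp t u => occurs_pred p t \/ occurs_pred p u
  | TLam t => occurs_pred p t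
  | _ => False
  end.

(** A term stands for its conversion class, so a name occurs in it only if it
    occurs in all its representatives.  As reduction never introduces names,
    these are the names that occur in its normal form. *)
Definition supp G a (t : tm G a) (c : nom) : Prop :=
  forall u, conv t u -> occurs_nom c u.
Definition fv G a (t : tm G a) (x : var) : Prop :=
  forall u, conv t u -> occurs_var x u.

(** * Permutations of nominal constants *)

Record perm : Type := Perm {
  pfun : oty -> nat -> nat;
  pinv : oty -> nat -> nat;
  pfunK : forall a n, pinv a (pfun a n) = n;
  pinvK : forall a n, pfun a (pinv a n) = n;
  pfin : exists l : list nom, forall a n, ~ In (a, n) l -> pfun a n = n
}.

Definition pnom (pi : perm) (c : nom) : nom := (fst c, pfun pi (fst c) (snd c)).

Fixpoint pact (pi : perm) G a (t : tm G a) : tm G a :=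
  match t in tm G a return tm G a with
  | TBound m => TBound m
  | TVar a n => TVar a n
  | TNom a n => TNom a (pfun pi a n)
  | TFun f => TFun f
  | TPred p => TPred p
  | TLog _ l => TLog _ l
  | TApp t u => TApp (pact pi t) (pact pi u)
  | TLam t => TLam (pact pi t)
  end.

Definition approx G a (t u : tm G a) : Prop := exists pi, conv t (pact pi u).

(** * Substitutions *)

Record subst : Type := Subst {
  sfun :> forall (a : oty) (n : nat), tm [] a;
  sfin : exists l : list var, forall a n, ~ In (a, n) l -> sfun a n = TVar a n
}.

Fixpoint sapp (th : subst) G a (t : tm G a) : tm G a :=
  match t in tm G a return tm G a with
  | TBound m => TBound m
  | TVar a n => wk0 _ (th a n)
  | TNom a n => TNom a n
  | TFun f => TFun f
  | TPred p => TPred p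
  | TLog _ l => TLog _ l
  | TApp t u => TApp (sapp th t) (sapp th u)
  | TLam t => TLam (sapp th t)
  end.

Definition ssupp (th : subst) (c : nom) : Prop :=
  exists a n, supp (th a n) c.

Definition sdom (th : subst) (x : var) : Prop :=
  ~ conv (th (fst x) (snd x)) (TVar (fst x) (snd x)).

Definition ctx : Type := var -> Prop.

(** Sigma theta *)
Definition ctx_sub (Sig : ctx) (th : subst) : ctx :=
  fun y => (Sig y /\ ~ sdom th y)
           \/ exists x, sdom th x /\ fv (th (fst x) (snd x)) y.

Definition srestr_fun (th : subst) (Sig : ctx) (a : oty) (n : nat) : tm [] a :=
  if excluded_middle_informative (Sig (a, n)) then th a n else TVar a n.

Lemma srestr_fin (th : subst) (Sig : ctx) :
  exists l : list var, forall a n, ~ In (a, n) l -> srestr_fun th Sig a n = TVar a n.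
Proof.
  destruct (sfin th) as [l Hl]; exists l; intros a n Hn; unfold srestr_fun.
  destruct (excluded_middle_informative _); [exact (Hl a n Hn)|reflexivity].
Qed.

Definition srestr (th : subst) (Sig : ctx) : subst := Subst (srestr_fin th Sig).

Lemma spact_fin (pi : perm) (th : subst) :
  exists l : list var, forall a n, ~ In (a, n) l -> pact pi (th a n) = TVar a n.
Proof.
  destruct (sfin th) as [l Hl]; exists l; intros a n Hn.
  rewrite (Hl a n Hn); reflexivity.
Qed.

(** pi.theta *)
Definition spact (pi : perm) (th : subst) : subst := Subst (spact_fin pi th).

Lemma scomp_fin (th rho : subst) :
  exists l : list var, forall a n, ~ In (a, n) l -> sapp rho (th a n) = TVar a n.
Proof.
  destruct (sfin th) as [l Hl]; destruct (sfin rho) as [l' Hl'].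
  exists (l ++ l'); intros a n Hn.
  rewrite (Hl a n (fun H => Hn (in_or_app _ _ _ (or_introl H)))); simpl.
  rewrite (Hl' a n (fun H => Hn (in_or_app _ _ _ (or_intror H)))); reflexivity.
Qed.

(** theta o rho, i.e. first theta, then rho *)
Definition scomp (th rho : subst) : subst := Subst (scomp_fin th rho).

Definition sconv (th rho : subst) : Prop := forall a n, conv (th a n) (rho a n).

Definition sapprox (th rho : subst) : Prop := exists pi, sconv th (spact pi rho).

(** B<theta> and the bullet composition of theta and rho depend on the choice of a permutation, and are
    determined by it only up to [approx] and [sapprox]; hence they are
    relations: [csapp th B B'] says that B' is a value of B<theta>, and
    [sbullet th rho ta] that ta is a value of the nominal-capture-avoiding
    composition of theta and rho. *)
Definition avoids (pi : perm) G a (t : tm G a) (th : subst) : Prop :=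
  forall c, supp t c -> ~ ssupp th (pnom pi c).

Definition csapp (th : subst) (B B' : form) : Prop :=
  exists pi, avoids pi B th /\ conv B' (sapp th (pact pi B)).

Definition sbullet (th rho ta : subst) : Prop :=
  exists pi, (forall c, ~ (ssupp (spact pi th) c /\ ssupp rho c))
             /\ sconv ta (scomp (spact pi th) rho).

Definition sle (rho th : subst) : Prop :=
  exists sigma ta, sbullet th sigma ta /\ sapprox rho ta.

Definition sle_on (Sig : ctx) (rho th : subst) : Prop :=
  sle (srestr rho Sig) (srestr th Sig).

(** * Nominal abstraction *)

Fixpoint mem_weak (E : list ty) G a (m : mem G a) : mem (G ++ E) a :=
  match m in mem G a return mem (G ++ E) a with
  | here _ _ => here _ _
  | there _ m' => there _ (mem_weak E m')
  end.

Fixpoint mem_last (b : ty) (G : list ty) : mem (G ++ [b]) b :=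
  match G return mem (G ++ [b]) b with
  | [] => here _ _
  | c :: G => there c (mem_last b G)
  end.

(** Replaces the nominal constant [c] by a new bound variable, placed last in
    the context. *)
Fixpoint abs_nom (c : nom) G a (t : tm G a) : tm (G ++ [oty_ty (fst c)]) a :=
  match t in tm G a return tm (G ++ [oty_ty (fst c)]) a with
  | TBound m => TBound (mem_weak _ m)
  | TVar a n => TVar a n
  | TNom a n =>
      match excluded_middle_informative (c = (a, n)) with
      | left e => eq_rect c (fun d => tm _ (oty_ty (fst d)))
                    (TBound (mem_last (oty_ty (fst c)) _)) (a, n) e
      | right _ => TNom a n
      end
  | TFun f => TFun f
  | TPred p => TPred p
  | TLog _ l => TLog _ l
  | TApp t u => TApp (abs_nom c t) (abs_nom c u)
  | TLam t => TLam (abs_nom c t)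
  end.

(** lambda c1 ... lambda cn. t *)
Fixpoint nlams (cs : list nom) b (t : tm [] b) :
    tm [] (arrows (tys (map fst cs)) b) :=
  match cs return tm [] (arrows (tys (map fst cs)) b) with
  | [] => t
  | c :: cs => TLam (abs_nom c (nlams cs t))
  end.

Inductive nabs_holds : forall l b, tm [] (arrows l b) -> tm [] b -> Prop :=
| NabsHolds (cs : list nom) b (s : tm [] (arrows (tys (map fst cs)) b))
    (t : tm [] b) :
    NoDup cs -> conv s (nlams cs t) -> nabs_holds s t.

Definition solution l b (s : tm [] (arrows l b)) (t : tm [] b) (th : subst) : Prop :=
  exists pi, avoids pi (nabs s t) th
             /\ nabs_holds (sapp th (pact pi s)) (sapp th (pact pi t)).

(** Complete sets of nominal abstraction solutions *)
Definition complete_set (Sig : ctx) l b (s : tm [] (arrows l b)) (t : tm [] b)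
    (S : subst -> Prop) : Prop :=
  (forall th, S th -> solution s t th)
  /\ forall rho, solution s t rho -> exists th, S th /\ sle_on Sig rho th.

(** * Definitions *)

Inductive kind : Type := Fix | Mu | Nu.

Record clause : Type := Clause {
  cl_kind : kind;
  cl_pred : psym sg;
  cl_body : tm [] (Arr (arrows (tys (pargs cl_pred)) O)
                       (arrows (tys (pargs cl_pred)) O))
}.

(** B S ts *)
Definition unfold_body (d : clause) (S : tm [] (arrows (tys (pargs (cl_pred d))) O))
    (ts : args [] (tys (pargs (cl_pred d)))) : form :=
  apps (TApp (cl_body d) S) ts.

Fixpoint const_top (l : list ty) : forall G, tm G (arrows l O) :=
  match l return forall G, tm G (arrows l O) with
  | [] => fun G => top G
  | a :: l => fun G => TLam (const_top l (a :: G))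
  end.

Inductive has_level (lvl : psym sg -> nat) : forall G, tm G O -> nat -> Prop :=
| lvl_atom G p (ts : args G (tys (pargs p))) : has_level lvl (atom ts) (lvl p)
| lvl_top G : has_level lvl (top G) 0
| lvl_bot G : has_level lvl (bot G) 0
| lvl_nabs G l b (s : tm G (arrows l b)) (t : tm G b) : has_level lvl (nabs s t) 0
| lvl_conj G (B C : tm G O) m n :
    has_level lvl B m -> has_level lvl C n -> has_level lvl (conj B C) (max m n)
| lvl_disj G (B C : tm G O) m n :
    has_level lvl B m -> has_level lvl C n -> has_level lvl (disj B C) (max m n)
| lvl_imp G (B C : tm G O) m n :
    has_level lvl B m -> has_level lvl C n -> has_level lvl (imp B C) (max (m + 1) n)
| lvl_all G a (B : tm (oty_ty a :: G) O) n : has_level lvl B n -> has_level lvl (all B) n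
| lvl_ex G a (B : tm (oty_ty a :: G) O) n : has_level lvl B n -> has_level lvl (ex B) n
| lvl_nabla G a (B : tm (oty_ty a :: G) O) n :
    has_level lvl B n -> has_level lvl (nabla B) n.

(** The level of a formula is read off a convertible formula whose logical
    structure is exposed, such as its normal form. *)
Definition stratified (defs : list clause) : Prop :=
  exists lvl : psym sg -> nat,
  forall d, In d defs ->
  forall xs ts, @var_args (pargs (cl_pred d)) xs ts -> NoDup xs ->
  exists B n, conv (unfold_body (const_top _ _) ts) B
              /\ has_level lvl B n /\ n < lvl (cl_pred d).

Record definition_ok (defs : list clause) : Prop := DefinitionOk {
  def_functional : NoDup (map cl_pred defs);
  def_pred : forall d, In d defs -> ~ occurs_pred (cl_pred d) (cl_body d);
  def_var : forall d, In d defs -> forall x, ~ occurs_var x (cl_body d);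
  def_nom : forall d, In d defs -> forall c, ~ occurs_nom c (cl_body d);
  def_strat : stratified defs
}.

(** * Sequents *)

Record sequent : Type := Seq {
  sctx : ctx;
  hyps : list form;
  goal : form
}.

Definition sequent_ok (q : sequent) : Prop :=
  (exists l : list var, forall x, sctx q x -> In x l)
  /\ (forall B, In B (hyps q) -> forall x, fv B x -> sctx q x)
  /\ forall x, fv (goal q) x -> sctx q x.

(** Signatures are sets, antecedents are multisets and formulas are taken up to
    conversion: this is the resulting identity of sequents. *)
Definition seq_eq (q q' : sequent) : Prop :=
  (forall x, sctx q x <-> sctx q' x)
  /\ (exists G, Permutation (hyps q) G /\ Forall2 (@conv [] O) G (hyps q'))
  /\ conv (goal q) (goal q').

(** * Rules *)

(** A rule relates the set of premises and the conclusion of its instances. *)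
Definition rule : Type := (sequent -> Prop) -> sequent -> Prop.

Definition prem (l : list sequent) : sequent -> Prop := fun q => In q l.

Definition ext (Sig : ctx) (h : var) : ctx := fun x => Sig x \/ x = h.

Definition lists_supp G a (t : tm G a) (cs : list nom) : Prop :=
  NoDup cs /\ forall c, In c cs <-> supp t c.

(** The variable [h = (_, n)] of type [map fst cs -> a], applied to [cs] *)
Definition raised (cs : list nom) (a : oty) : oty := oarrows (map fst cs) a.
Definition raise (cs : list nom) (a : oty) (n : nat) : tm [] a :=
  @apps [] (tys (map fst cs)) a (TVar (raised cs a) n) (nom_args [] cs).

(** All rules of the logic except the left rule for nominal abstraction. *)
Inductive core (defs : list clause) : rule :=
| r_id Sig Ga B B' : approx B B' -> core defs (prem []) (Seq Sig (B :: Ga) B')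
| r_cut Sig Ga De B C :
    core defs (prem [Seq Sig Ga B; Seq Sig (B :: De) C]) (Seq Sig (Ga ++ De) C)
| r_contr Sig Ga B C :
    core defs (prem [Seq Sig (B :: B :: Ga) C]) (Seq Sig (B :: Ga) C)
| r_botL Sig Ga C : core defs (prem []) (Seq Sig (bot [] :: Ga) C)
| r_topR Sig Ga : core defs (prem []) (Seq Sig Ga (top []))
| r_disjL Sig Ga B D C :
    core defs (prem [Seq Sig (B :: Ga) C; Seq Sig (D :: Ga) C])
         (Seq Sig (disj B D :: Ga) C)
| r_disjR1 Sig Ga B D : core defs (prem [Seq Sig Ga B]) (Seq Sig Ga (disj B D))
| r_disjR2 Sig Ga B D : core defs (prem [Seq Sig Ga D]) (Seq Sig Ga (disj B D))
| r_conjL1 Sig Ga B D C :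
    core defs (prem [Seq Sig (B :: Ga) C]) (Seq Sig (conj B D :: Ga) C)
| r_conjL2 Sig Ga B D C :
    core defs (prem [Seq Sig (D :: Ga) C]) (Seq Sig (conj B D :: Ga) C)
| r_conjR Sig Ga B C :
    core defs (prem [Seq Sig Ga B; Seq Sig Ga C]) (Seq Sig Ga (conj B C))
| r_impL Sig Ga B D C :
    core defs (prem [Seq Sig Ga B; Seq Sig (D :: Ga) C]) (Seq Sig (imp B D :: Ga) C)
| r_impR Sig Ga B C :
    core defs (prem [Seq Sig (B :: Ga) C]) (Seq Sig Ga (imp B C))
| r_allL Sig Ga (a : oty) (B : tm [oty_ty a] O) (t : tm [] a) C :
    (forall x, fv t x -> Sig x) ->
    core defs (prem [Seq Sig (inst B t :: Ga) C]) (Seq Sig (all B :: Ga) C)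
| r_allR Sig Ga (a : oty) (B : tm [oty_ty a] O) cs n :
    lists_supp B cs -> ~ Sig (raised cs a, n) ->
    core defs (prem [Seq (ext Sig (raised cs a, n)) Ga (inst B (raise cs a n))])
         (Seq Sig Ga (all B))
| r_exL Sig Ga (a : oty) (B : tm [oty_ty a] O) C cs n :
    lists_supp B cs -> ~ Sig (raised cs a, n) ->
    core defs (prem [Seq (ext Sig (raised cs a, n)) (inst B (raise cs a n) :: Ga) C])
         (Seq Sig (ex B :: Ga) C)
| r_exR Sig Ga (a : oty) (B : tm [oty_ty a] O) (t : tm [] a) :
    (forall x, fv t x -> Sig x) ->
    core defs (prem [Seq Sig Ga (inst B t)]) (Seq Sig Ga (ex B))
| r_nablaL Sig Ga (a : oty) (B : tm [oty_ty a] O) C n :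
    ~ supp B (a, n) ->
    core defs (prem [Seq Sig (inst B (TNom a n) :: Ga) C]) (Seq Sig (nabla B :: Ga) C)
| r_nablaR Sig Ga (a : oty) (B : tm [oty_ty a] O) n :
    ~ supp B (a, n) ->
    core defs (prem [Seq Sig Ga (inst B (TNom a n))]) (Seq Sig Ga (nabla B))
| r_nabsR Sig Ga l b (s : tm [] (arrows l b)) (t : tm [] b) :
    nabs_holds s t -> core defs (prem []) (Seq Sig Ga (nabs s t))
| r_defL Sig Ga d ts C :
    In d defs ->
    core defs (prem [Seq Sig (unfold_body (d := d) (TPred (cl_pred d)) ts :: Ga) C])
         (Seq Sig (atom ts :: Ga) C)
| r_defR Sig Ga d ts :
    In d defs ->
    core defs (prem [Seq Sig Ga (unfold_body (d := d) (TPred (cl_pred d)) ts)])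
         (Seq Sig Ga (atom ts))
(* [S] is closed: in its premise, the only eigenvariables are [xs]. *)
| r_ind Sig Ga d ts C S xs vs :
    In d defs -> cl_kind d = Mu ->
    (forall c, ~ occurs_nom c S) -> (forall x, ~ occurs_var x S) ->
    NoDup xs -> @var_args (pargs (cl_pred d)) xs vs ->
    core defs (prem [Seq (fun x => In x xs) [unfold_body (d := d) S vs] (apps S vs);
                     Seq Sig (apps S ts :: Ga) C])
         (Seq Sig (atom ts :: Ga) C)
| r_coind Sig Ga d ts S xs vs :
    In d defs -> cl_kind d = Nu ->
    (forall c, ~ occurs_nom c S) -> (forall x, ~ occurs_var x S) ->
    NoDup xs -> @var_args (pargs (cl_pred d)) xs vs ->
    core defs (prem [Seq Sig Ga (apps S ts);
                     Seq (fun x => In x xs) [apps S vs] (unfold_body (d := d) S vs)])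
         (Seq Sig Ga (atom ts)).

(** [q] is the sequent Sigma theta : Gamma<theta> |- C<theta>, for some choice
    of the permutations involved. *)
Definition seq_instance (th : subst) (Sig : ctx) (Ga : list form) (C : form)
    (q : sequent) : Prop :=
  (forall x, sctx q x <-> ctx_sub Sig th x)
  /\ Forall2 (csapp th) Ga (hyps q)
  /\ csapp th C (goal q).

(** Left rules for nominal abstraction: an instance has one premise for each
    substitution in [S], where [sel Sig s t S] tells which sets [S] may be
    used. *)
Definition selection : Type :=
  ctx -> forall l b, tm [] (arrows l b) -> tm [] b -> (subst -> Prop) -> Prop.

Inductive nabs_left (sel : selection) : rule :=
| NabsLeft Sig Ga C l b (s : tm [] (arrows l b)) (t : tm [] b)
    (S : subst -> Prop) (F : subst -> sequent) :
    sel Sig l b s t S ->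
    (forall th, S th -> seq_instance th Sig Ga C (F th)) ->
    nabs_left sel (fun q => exists th, S th /\ q = F th)
              (Seq Sig (nabs s t :: Ga) C).

Definition nabsL : rule :=
  nabs_left (fun Sig l b s t S => forall th, S th <-> solution s t th).

Definition nabsL_csnas : rule := nabs_left complete_set.

(** The variant of [nabsL_csnas] in which the complete set to be used is fixed
    beforehand, as a function of [Sig], [s] and [t]. *)
Definition solution_sets : Type :=
  ctx -> forall l b, tm [] (arrows l b) -> tm [] b -> subst -> Prop.

Definition nabsL_fixed (csnas : solution_sets) : rule :=
  nabs_left (fun Sig l b s t S => forall th, S th <-> csnas Sig l b s t th).

(** * Derivability *)

Inductive derivable (R : rule) : sequent -> Prop :=
| Derive P q q' :
    R P q -> seq_eq q q' -> sequent_ok q' ->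
    (forall p, P p -> derivable R p) -> derivable R q'.

(** The logic with [L] as its left rule for nominal abstraction. *)
Definition logic_with (defs : list clause) (L : rule) : rule :=
  fun P q => core defs P q \/ L P q.

Definition admissible (L R : rule) : Prop :=
  forall P q, L P q -> sequent_ok q -> (forall p, P p -> derivable R p) ->
  derivable R q.

Definition inter_admissible (defs : list clause) (L L' : rule) : Prop :=
  admissible L (logic_with defs L')
  /\ admissible L' (logic_with defs L)
  /\ forall q, derivable (logic_with defs L) q <-> derivable (logic_with defs L') q.

End Terms.

(* Main.v *)
From Stdlib Require Import List Permutation Classical ClassicalEpsilon Arith Lia Eqdep.
From Stdlib Require Import Program.Equality.
Require Import Defs.
Import ListNotations.

(** Every solution is an instance, in the sense of the bullet composition, of a
    member of a complete set of solutions, so the premises of the unrestricted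
    rule follow from those of the CSNAS rule once derivability is known to be
    closed under capture-avoiding instantiation [B<theta>].  This closure is
    proved by induction on derivations: the nominal abstraction rule is
    preserved because a solution of an instance of [s |> t] under [sigma]
    composes with [sigma] to a solution of [s |> t].  Values of [B<theta>] are
    unique only up to [approx], but cut and the initial rule make derivability
    invariant under [approx] in each formula separately.  Eigenvariables that
    are not wanted in the final signature are instantiated by nominal
    constants, which inhabit all types.

    The support of a term is defined through its conversion class.  No normal
    form is needed to work with it: a name outside the support can be renamed to
    a fresh one without leaving the class.  Only the facts that a nominal
    abstraction determines its two arguments up to conversion, and that a
    quantified formula has the free variables of its body, need an analysis of
    conversion, by a Kripke logical relation based on weak head reduction. *)

Set Implicit Arguments.
Unset Strict Implicit.
Unset Printing Implicit Defensive.

Section Inter.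

Context (sg : signature).

Local Notation ty := (ty (base sg)).
Local Notation oty := (oty (base sg)).
Local Notation tm := (@tm sg).
Local Notation mem := (@mem sg).
Local Notation bsub := (@bsub sg).
Local Notation ren := (@ren sg).
Local Notation var := (var sg).
Local Notation nom := (nom sg).

Implicit Types th rho ta : subst sg.
Implicit Types p q pi : perm sg.

(** * Simultaneous substitution of bound variables and names *)

(** The order [sle_on] compares substitutions only on [Sig] and up to a permutation, so the
    substitution that takes the premise at [th] to the premise at [rho] need not carry the signature
    of the one to that of the other. Closure under instantiation is therefore stated for any target
    signature containing the free variables of the instance. The price is that a derivation may use
    eigenvariables, in witnesses of quantifier rules or in cut formulas, that have no counterpart in
    the target signature; this forces the substitution to be corrected before a rule is treated. In
    the other direction, the set of all solutions is itself complete because the order is reflexive,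
    and a complete set fixed beforehand merely selects some of the premises that are available. *)

(** The predicate is abstracted inside the match, since its type mentions the head and the tail of
    the context that is being analysed. *)
Lemma mem_cons_ind (c : ty) G (P : forall a, mem (c :: G) a -> Prop) :
  P c (here _ _) -> (forall a m, P a (there c m)) -> forall a m, P a m.
Proof.
  intros Hh Ht a m.
  refine (match m as m' in Defs.mem G' a' return
    match G' as G0 return forall a0, mem G0 a0 -> Prop with
    | [] => fun _ _ => True
    | c0 :: G0 => fun a0 m0 => forall P : forall a, mem (c0 :: G0) a -> Prop,
        P c0 (here _ _) -> (forall a m, P a (there c0 m)) -> P a0 m0
    end a' m' with
    | here _ _ => fun P H1 _ => H1
    | there _ m => fun P _ H2 => H2 _ m
    end P Hh Ht).
Qed.

Lemma mem_nil_elim a (m : mem [] a) (P : Prop) : P.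
Proof.
  exact (match m in Defs.mem G' _ return
    match G' with [] => P | _ => True end with here _ _ => I | there _ _ => I end).
Qed.

Lemma rename_ext G a (t : tm G a) : forall D (r r' : ren G D),
  (forall b m, r b m = r' b m) -> rename t r = rename t r'.
Proof.
  induction t; simpl; intros D r r' H; try reflexivity.
  - rewrite H; reflexivity.
  - rewrite (IHt1 _ r r' H), (IHt2 _ r r' H); reflexivity.
  - f_equal; apply IHt; apply mem_cons_ind; [reflexivity|].
    intros c m; simpl; rewrite H; reflexivity.
Qed.

Lemma rename_rename G a (t : tm G a) : forall D E (r : ren G D) (r' : ren D E),
  rename (rename t r) r' = rename t (fun b m => r' _ (r _ m)).
Proof.
  induction t; simpl; intros D E r r'; try reflexivity.
  - rewrite IHt1, IHt2; reflexivity.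
  - f_equal; rewrite IHt; apply rename_ext, mem_cons_ind; reflexivity.
Qed.

Lemma rename_id G a (t : tm G a) : forall r : ren G G,
  (forall b m, r b m = m) -> rename t r = t.
Proof.
  induction t; simpl; intros r H; try reflexivity.
  - rewrite H; reflexivity.
  - rewrite IHt1, IHt2; auto.
  - rewrite IHt; [reflexivity|]; apply mem_cons_ind; [reflexivity|].
    intros c m; simpl; rewrite H; reflexivity.
Qed.

(** Names are eigenvariables (tag [true]) and nominal constants (tag [false]),
    treated uniformly. *)
Definition nm G (k : bool) (a : oty) (n : nat) : tm G a :=
  if k then TVar G a n else TNom G a n.

Definition occ (k : bool) (c : oty * nat) G a (t : tm G a) : Prop :=
  if k then occurs_var c t else occurs_nom c t.

Definition nsub (D : list ty) : Type := forall (k : bool) (a : oty), nat -> tm D a.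

(** A single traversal of which [rename], [bsubst], [inst], [pact], [sapp] and [abs_nom] are all
    instances; most commutation laws between these operations then reduce to [gs_gs] and
    [gs_ext]. *)
Fixpoint gs G a (t : tm G a) : forall D, bsub G D -> nsub D -> tm D a :=
  match t in Defs.tm G a return forall D, bsub G D -> nsub D -> tm D a with
  | TBound m => fun D s f => s _ m
  | TVar _ a n => fun D s f => f true a n
  | TNom _ a n => fun D s f => f false a n
  | TFun _ g => fun D s f => TFun D g
  | TPred _ p => fun D s f => TPred D p
  | TLog _ l => fun D s f => TLog D l
  | TApp t u => fun D s f => TApp (gs t s f) (gs u s f)
  | TLam t => fun D s f => TLam (gs t (up_bsub s) (fun k a n => shift _ (f k a n)))
  end.

Definition idb G : bsub G G := fun a m => TBound m.

Lemma gs_ext G a (t : tm G a) : forall D (s s' : bsub G D) (f f' : nsub D),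
  (forall b m, s b m = s' b m) ->
  (forall k b n, occ k (b, n) t -> f k b n = f' k b n) ->
  gs t s f = gs t s' f'.
Proof.
  induction t; simpl; intros D s s' f0 f' H Hf; try reflexivity.
  - apply H.
  - apply Hf; reflexivity.
  - apply Hf; reflexivity.
  - rewrite (IHt1 _ s s' f0 f' H), (IHt2 _ s s' f0 f' H); [reflexivity| |];
      intros [] c n Hc; apply Hf; simpl in *; auto.
  - f_equal; apply IHt.
    + apply mem_cons_ind; [reflexivity|]; intros c m; simpl; rewrite H; reflexivity.
    + intros k c n Hc; rewrite (Hf k c n); [reflexivity|]; destruct k; exact Hc.
Qed.

Lemma gs_id G a (t : tm G a) (s : bsub G G) (f : nsub G) :
  (forall b m, s b m = TBound m) ->
  (forall k b n, occ k (b, n) t -> f k b n = nm G k b n) -> gs t s f = t.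
Proof.
  intros Hs Hf; rewrite (gs_ext Hs Hf); clear s f Hs Hf.
  induction t; simpl; try reflexivity.
  - rewrite IHt1, IHt2; reflexivity.
  - f_equal; rewrite <- IHt at 2; apply gs_ext.
    + apply mem_cons_ind; reflexivity.
    + intros [] c n _; reflexivity.
Qed.

Lemma gs_rename G a (t : tm G a) : forall D E (r : ren G D) (s : bsub D E) (f : nsub E),
  gs (rename t r) s f = gs t (fun b m => s _ (r _ m)) f.
Proof.
  induction t; simpl; intros D E r s f0; try reflexivity.
  - rewrite IHt1, IHt2; reflexivity.
  - f_equal; rewrite IHt; apply gs_ext; [|reflexivity].
    apply mem_cons_ind; reflexivity.
Qed.

Lemma shift_rename G D a b (t : tm G a) (r : ren G D) :
  rename (shift b t) (up_ren r) = shift b (rename t r).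
Proof. unfold shift; rewrite !rename_rename; reflexivity. Qed.

Lemma rename_gs G a (t : tm G a) : forall D E (s : bsub G D) (f : nsub D) (r : ren D E),
  rename (gs t s f) r = gs t (fun b m => rename (s _ m) r) (fun k b n => rename (f k b n) r).
Proof.
  induction t; simpl; intros D E s f0 r; try reflexivity.
  - rewrite IHt1, IHt2; reflexivity.
  - f_equal; rewrite IHt; apply gs_ext.
    + apply mem_cons_ind; [reflexivity|]; intros c m; apply shift_rename.
    + intros; apply shift_rename.
Qed.

Lemma shift_gs G D a b (t : tm G a) (s : bsub G D) (f : nsub D) :
  gs (shift b t) (up_bsub s) (fun k a n => shift b (f k a n)) = shift b (gs t s f).
Proof. unfold shift at 1 3; rewrite gs_rename, rename_gs; reflexivity. Qed.

Lemma gs_gs G a (t : tm G a) : forall D E (s : bsub G D) (f : nsub D) (s' : bsub D E) (f' : nsub E),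
  gs (gs t s f) s' f' = gs t (fun b m => gs (s _ m) s' f') (fun k b n => gs (f k b n) s' f').
Proof.
  induction t; simpl; intros D E s f0 s' f'; try reflexivity.
  - rewrite IHt1, IHt2; reflexivity.
  - f_equal; rewrite IHt; apply gs_ext.
    + apply mem_cons_ind; [reflexivity|]; intros c m; apply shift_gs.
    + intros; apply shift_gs.
Qed.

Lemma rename_as_gs G D a (t : tm G a) (r : ren G D) :
  rename t r = gs t (fun b m => TBound (r _ m)) (nm D).
Proof.
  revert D r; induction t; simpl; intros D r; try reflexivity.
  - rewrite IHt1, IHt2; reflexivity.
  - f_equal; rewrite IHt; apply gs_ext.
    + apply mem_cons_ind; reflexivity.
    + intros [] c n _; reflexivity.
Qed.

Lemma bsubst_as_gs G D a (t : tm G a) (s : bsub G D) : bsubst t s = gs t s (nm D).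
Proof.
  revert D s; induction t; simpl; intros D s; try reflexivity.
  - rewrite IHt1, IHt2; reflexivity.
  - f_equal; rewrite IHt; apply gs_ext; [reflexivity|].
    intros [] c n _; reflexivity.
Qed.

Definition scons G D a (u : tm D a) (s : bsub G D) : bsub (a :: G) D :=
  fun c m =>
    match m in Defs.mem G' c' return
      match G' with [] => unit | a' :: G0 => tm D a' -> bsub G0 D -> tm D c' end
    with
    | here _ _ => fun u _ => u
    | there _ m' => fun _ s => s _ m'
    end u s.

Lemma inst_as_gs G a b (t : tm (a :: G) b) (u : tm G a) :
  inst t u = gs t (scons u (@idb G)) (nm G).
Proof.
  unfold inst; rewrite bsubst_as_gs; apply gs_ext; [|reflexivity].
  apply mem_cons_ind; reflexivity.
Qed.

Lemma gs_shift G D a b (t : tm G a) (u : tm D b) (s : bsub G D) (f : nsub D) :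
  gs (shift b t) (scons u s) f = gs t s f.
Proof. unfold shift; rewrite gs_rename; reflexivity. Qed.

(** Passing under the binder shifts the values of names; the instantiation undoes the shift by
    [gs_shift], so both sides are one substitution. *)
Lemma inst_gs_up G D a b (t : tm (a :: G) b) (s : bsub G D) (f : nsub D) (u : tm D a) :
  inst (gs t (up_bsub s) (fun k c n => shift a (f k c n))) u = gs t (scons u s) f.
Proof.
  rewrite inst_as_gs, gs_gs; apply gs_ext.
  - apply mem_cons_ind; [reflexivity|]; intros c m; simpl.
    rewrite gs_shift; apply gs_id; reflexivity.
  - intros k c n _; rewrite gs_shift; apply gs_id; reflexivity.
Qed.

Lemma gs_inst G D a b (t : tm (a :: G) b) (u : tm G a) (s : bsub G D) (f : nsub D) :
  gs (inst t u) s f =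
  inst (gs t (up_bsub s) (fun k c n => shift a (f k c n))) (gs u s f).
Proof.
  rewrite inst_gs_up, inst_as_gs, gs_gs; apply gs_ext.
  - apply mem_cons_ind; reflexivity.
  - intros [] c n _; reflexivity.
Qed.

Lemma gs_conv G a (t u : tm G a) : conv t u ->
  forall D (s : bsub G D) (f : nsub D), conv (gs t s f) (gs u s f).
Proof.
  induction 1; intros D s f.
  - apply conv_refl.
  - apply conv_sym, IHconv.
  - eapply conv_trans; [apply IHconv1|apply IHconv2].
  - simpl; apply conv_app; auto.
  - simpl; apply conv_lam; auto.
  - rewrite gs_inst; apply conv_beta.
  - simpl; rewrite shift_gs; apply conv_eta.
Qed.

Lemma rename_conv G D a (t u : tm G a) (r : ren G D) :
  conv t u -> conv (rename t r) (rename u r).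
Proof. intros H; rewrite !rename_as_gs; apply gs_conv, H. Qed.

Lemma gs_conv_ext G a (t : tm G a) : forall D (s s' : bsub G D) (f f' : nsub D),
  (forall b m, conv (s b m) (s' b m)) ->
  (forall k b n, occ k (b, n) t -> conv (f k b n) (f' k b n)) ->
  conv (gs t s f) (gs t s' f').
Proof.
  induction t; simpl; intros D s s' f0 f' H Hf; try apply conv_refl.
  - apply H.
  - apply Hf; reflexivity.
  - apply Hf; reflexivity.
  - apply conv_app; [apply IHt1|apply IHt2]; auto;
      intros [] c n Hc; apply Hf; simpl in *; auto.
  - apply conv_lam, IHt.
    + apply mem_cons_ind; [apply conv_refl|]; intros c m; apply rename_conv, H.
    + intros k c n Hc; apply rename_conv, Hf; destruct k; exact Hc.
Qed.

Lemma occ_rename k c G a (t : tm G a) : forall D (r : ren G D),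
  occ k c (rename t r) <-> occ k c t.
Proof.
  destruct k; simpl; induction t; simpl; intros D r; try tauto;
    try (rewrite IHt1, IHt2; tauto); apply IHt.
Qed.

Lemma occ_gs k c G a (t : tm G a) : forall D (s : bsub G D) (f : nsub D),
  occ k c (gs t s f) ->
  (exists b m, occ k c (s b m)) \/
  (exists k' b n, occ k' (b, n) t /\ occ k c (f k' b n)).
Proof.
  induction t; simpl; intros D s f0 H.
  - left; eauto.
  - right; exists true, a, n; simpl; auto.
  - right; exists false, a, n; simpl; auto.
  - destruct k; contradiction.
  - destruct k; contradiction.
  - destruct k; contradiction.
  - assert (H' : occ k c (gs t1 s f0) \/ occ k c (gs t2 s f0))
      by (destruct k; exact H).
    destruct H' as [H'|H']; [apply IHt1 in H'|apply IHt2 in H'];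
      (destruct H' as [?|(k' & b' & n & H1 & H2)]; [left; assumption|]);
      right; exists k', b', n; split; auto; destruct k'; simpl in *; auto.
  - assert (H' : occ k c (gs t (up_bsub s) (fun k a n => shift _ (f0 k a n))))
      by (destruct k; exact H).
    apply IHt in H'; destruct H' as [(b' & m & H')|(k' & b' & n & H1 & H2)].
    + left; revert b' m H'.
      refine (@mem_cons_ind a G (fun b' m => occ k c (up_bsub s m) -> _) _ _).
      * destruct k; contradiction.
      * intros b' m H'; exists b', m; apply occ_rename in H'; exact H'.
    + right; exists k', b', n; split; [destruct k'; exact H1|].
      apply occ_rename in H2; exact H2.
Qed.

Lemma occ_nm k c G k' a n : occ k c (nm G k' a n) -> k = k' /\ c = (a, n).
Proof. destruct k, k'; simpl; intuition. Qed.

Lemma occ_finite G a (t : tm G a) :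
  exists L, forall k c, occ k c t -> In (k, c) L.
Proof.
  induction t; try (exists []; intros []; simpl; tauto).
  - exists [(true, (a, n))]; intros [] c H; simpl in H; [subst; simpl; auto|contradiction].
  - exists [(false, (a, n))]; intros [] c H; simpl in H; [contradiction|subst; simpl; auto].
  - destruct IHt1 as [L1 H1], IHt2 as [L2 H2]; exists (L1 ++ L2); intros k c H.
    apply in_or_app.
    assert (H' : occ k c t1 \/ occ k c t2) by (destruct k; exact H).
    destruct H'; [left; apply H1|right; apply H2]; assumption.
  - destruct IHt as [L HL]; exists L; intros k c H; apply HL; destruct k; exact H.
Qed.

Lemma index_bound (L : list (bool * (oty * nat))) :
  exists N, forall k a n, In (k, (a, n)) L -> n < N.
Proof.
  induction L as [|[k [a n]] L [N HN]]; [exists 0; simpl; tauto|].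
  exists (Nat.max N (S n)); intros k' a' n' [H|H]; [inversion H; lia|].
  specialize (HN _ _ _ H); lia.
Qed.

(** * Support and freshening *)

(** Common form of [supp] (tag [false]) and [fv] (tag [true]), so that facts about occurrence up to
    conversion are proved once. *)
Definition sup (k : bool) (c : oty * nat) G a (t : tm G a) : Prop :=
  forall u, conv t u -> occ k c u.

Lemma supp_sup G a (t : tm G a) c : supp t c <-> sup false c t.
Proof. reflexivity. Qed.

Lemma fv_sup G a (t : tm G a) c : fv t c <-> sup true c t.
Proof. reflexivity. Qed.

Lemma sup_occ k c G a (t : tm G a) : sup k c t -> occ k c t.
Proof. intros H; apply H, conv_refl. Qed.

Lemma sup_conv k c G a (t u : tm G a) : conv t u -> sup k c t -> sup k c u.
Proof. intros H Ht v Hv; apply Ht; eapply conv_trans; eauto. Qed.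

Lemma supp_occurs c G a (t : tm G a) : supp t c -> occurs_nom c t.
Proof. exact (@sup_occ false c G a t). Qed.

Lemma fv_occurs x G a (t : tm G a) : fv t x -> occurs_var x t.
Proof. exact (@sup_occ true x G a t). Qed.

Lemma supp_conv c G a (t u : tm G a) : conv t u -> supp t c -> supp u c.
Proof. exact (@sup_conv false c G a t u). Qed.

Lemma fv_conv x G a (t u : tm G a) : conv t u -> fv t x -> fv u x.
Proof. exact (@sup_conv true x G a t u). Qed.

Lemma not_sup k c G a (t : tm G a) : ~ sup k c t -> exists u, conv t u /\ ~ occ k c u.
Proof.
  intros H; apply not_all_ex_not in H; destruct H as [u H].
  exists u; apply imply_to_and in H; exact H.
Qed.

(** A replacement and not a transposition: for [n1] different from [n0] the old name disappears from
    the result, which a swap would not ensure. *)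
Definition replace_index (k0 : bool) (a0 : oty) (n0 n1 : nat) G : nsub G :=
  fun k a n => nm G k a
    (if excluded_middle_informative ((k, (a, n)) = (k0, (a0, n0))) then n1 else n).

Lemma occ_replace_index k0 a0 n0 n1 G a (t : tm G a) k c :
  occ k c (gs t (@idb G) (@replace_index k0 a0 n0 n1 G)) ->
  (k, c) = (k0, (a0, n1)) \/ occ k c t /\ (k, c) <> (k0, (a0, n0)).
Proof.
  intros H; apply occ_gs in H; destruct H as [(b & m & H)|(k' & b & n & H1 & H2)].
  - destruct k; contradiction.
  - unfold replace_index in H2; destruct (excluded_middle_informative _) as [e|e];
      apply occ_nm in H2; destruct H2; subst; [left; congruence|right; auto].
Qed.

(* A name outside the support of [t] is missing from some [u] convertible to [t],
   so renaming it to a name fresh for [u] turns [t] into a convertible term. *)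
Lemma freshen G a (t : tm G a) (L : list (bool * (oty * nat))) :
  exists t', conv t t' /\
    forall k c, occ k c t' -> sup k c t \/ ~ In (k, c) L.
Proof.
  destruct (occ_finite t) as [Lt HLt].
  (* The list [l] collects the names already treated: an occurrence left over from [t] is in the
     support if it is listed, and every new occurrence avoids both [L] and the names of [t]. *)
  assert (H : forall l, exists t', conv t t' /\ forall k c, occ k c t' ->
      (occ k c t /\ (In (k, c) l -> sup k c t)) \/ ~ In (k, c) (L ++ Lt)).
  { induction l as [|[k0 [a0 n0]] l (t' & Hc & Ht')].
    - exists t; split; [apply conv_refl|]; intros k c H; left; simpl; tauto.
    - destruct (excluded_middle_informative (sup k0 (a0, n0) t)) as [Hs|Hs].
      + exists t'; split; [exact Hc|]; intros k c H; destruct (Ht' _ _ H) as [[H1 H2]|H1];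
          [left; split; [exact H1|]|right; exact H1].
        intros [e|Hin]; [inversion e; subst; exact Hs|auto].
      + destruct (not_sup Hs) as (u & Hu & Hou).
        destruct (index_bound (L ++ Lt)) as [n1 Hn1].
        exists (gs t' (@idb G) (@replace_index k0 a0 n0 n1 G)); split.
        * eapply conv_trans; [exact Hu|].
          replace u with (gs u (@idb G) (@replace_index k0 a0 n0 n1 G)).
          -- apply gs_conv; eapply conv_trans; [apply conv_sym, Hu|exact Hc].
          -- apply gs_id; [reflexivity|]; intros k b n Ho; unfold replace_index.
             destruct (excluded_middle_informative _) as [e|e]; [|reflexivity].
             inversion e; subst; contradiction.
        * intros k c H; apply occ_replace_index in H; destruct H as [e|[H1 H2]].
          -- right; intros Hin; inversion e; subst; apply Hn1 in Hin; lia.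
          -- destruct (Ht' _ _ H1) as [[H3 H4]|H3]; [left|right; exact H3].
             split; [exact H3|]; intros [e|Hin]; [congruence|auto]. }
  destruct (H Lt) as (t' & Hc & Ht'); exists t'; split; [exact Hc|].
  intros k c Ho; destruct (Ht' _ _ Ho) as [[H1 H2]|H1]; [left; auto|right].
  intros Hin; apply H1, in_or_app; auto.
Qed.

(** Both sides may be computed from a representative given by [freshen], whose names all lie in the
    support of [t] or outside [L]; on such names [f] and [f'] agree up to conversion. *)
Lemma gs_conv_sup G D a (t : tm G a) (s : bsub G D) (f f' : nsub D) L :
  (forall k b n, sup k (b, n) t -> conv (f k b n) (f' k b n)) ->
  (forall k b n, ~ In (k, (b, n)) L -> conv (f k b n) (f' k b n)) ->
  conv (gs t s f) (gs t s f').
Proof.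
  intros Hs Hf; destruct (freshen t L) as (t' & Hc & Ht').
  eapply conv_trans; [apply gs_conv, Hc|].
  eapply conv_trans; [|apply conv_sym, gs_conv, Hc].
  apply gs_conv_ext; [intros; apply conv_refl|].
  intros k b n Ho; destruct (Ht' _ _ Ho); auto.
Qed.

(** Otherwise the value at each name in the support of [t] has a representative without [c];
    substituted into a freshened [t], these give a representative of the whole term in which [c]
    does not occur. *)
Lemma sup_gs G a (t : tm G a) (f : nsub G) L k c :
  (forall k b n, ~ In (k, (b, n)) L -> f k b n = nm G k b n) ->
  sup k c (gs t (@idb G) f) ->
  exists k' b n, sup k' (b, n) t /\ sup k c (f k' b n).
Proof.
  intros Hf H; apply NNPP; intros Hn.
  assert (Hch : forall k' b n, exists u, conv (f k' b n) u /\
            (~ sup k c (f k' b n) -> ~ occ k c u)).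
  { intros k' b n; destruct (excluded_middle_informative (sup k c (f k' b n))) as [e|e].
    - exists (f k' b n); split; [apply conv_refl|tauto].
    - destruct (not_sup e) as (u & H1 & H2); eauto. }
  pose (f' := fun k' b n => proj1_sig (constructive_indefinite_description _ (Hch k' b n))).
  assert (Hf' : forall k' b n, conv (f k' b n) (f' k' b n) /\
            (~ sup k c (f k' b n) -> ~ occ k c (f' k' b n)))
    by (intros; apply (proj2_sig (constructive_indefinite_description _ (Hch k' b n)))).
  (* With [(k, c)] in the list, [freshen] cannot introduce [c] itself. *)
  destruct (freshen t ((k, c) :: L)) as (t' & Hc & Ht').
  assert (Ho : occ k c (gs t' (@idb G) f')).
  { apply H; eapply conv_trans; [apply gs_conv, Hc|].
    apply gs_conv_ext; [intros; apply conv_refl|]; intros; apply Hf'. }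
  apply occ_gs in Ho; destruct Ho as [(b & m & Ho)|(k' & b & n & Ho & Ho')].
  - destruct k; contradiction.
  - revert Ho'; apply Hf'; intros Hs; destruct (Ht' _ _ Ho) as [H1|H1].
    + apply Hn; eauto.
    + rewrite Hf in Hs by (intros ?; apply H1; right; assumption).
      apply sup_occ, occ_nm in Hs; apply H1; left; destruct Hs; subst; reflexivity.
Qed.

(** * Permutations *)

Definition pnsub (pi : perm sg) G : nsub G :=
  fun k a n => nm G k a (if k then n else pfun pi a n).

Definition snsub (th : subst sg) G : nsub G :=
  fun k a n => if k then wk0 G (th a n) else TNom G a n.

Lemma shift_wk0 G a b (t : tm [] a) : shift b (wk0 G t) = wk0 (b :: G) t.
Proof.
  unfold shift, wk0; rewrite rename_rename; apply rename_ext.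
  intros c m; apply (mem_nil_elim m).
Qed.

Lemma wk0_nil a (t : tm [] a) : wk0 [] t = t.
Proof. apply rename_id; intros b m; apply (mem_nil_elim m). Qed.

Lemma wk0_conv G a (t u : tm [] a) : conv t u -> conv (wk0 G t) (wk0 G u).
Proof. apply rename_conv. Qed.

Lemma sup_wk0 G k c a (t : tm [] a) : sup k c (wk0 G t) -> sup k c t.
Proof. intros H u Hu; eapply occ_rename, H, wk0_conv, Hu. Qed.

Lemma up_idb G (b : ty) : forall c (m : mem (b :: G) c), up_bsub (@idb G) m = TBound m.
Proof. apply mem_cons_ind; reflexivity. Qed.

Lemma pact_as_gs pi G a (t : tm G a) : pact pi t = gs t (@idb G) (@pnsub pi G).
Proof.
  induction t; simpl; try reflexivity.
  - rewrite IHt1, IHt2; reflexivity.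
  - f_equal; rewrite IHt; apply gs_ext.
    + intros; symmetry; apply up_idb.
    + intros [] c n _; reflexivity.
Qed.

Lemma sapp_as_gs th G a (t : tm G a) : sapp th t = gs t (@idb G) (@snsub th G).
Proof.
  induction t; simpl; try reflexivity.
  - rewrite IHt1, IHt2; reflexivity.
  - f_equal; rewrite IHt; apply gs_ext.
    + intros; symmetry; apply up_idb.
    + intros [] c n _; [symmetry; apply shift_wk0|reflexivity].
Qed.

Lemma pact_conv pi G a (t u : tm G a) : conv t u -> conv (pact pi t) (pact pi u).
Proof. rewrite !pact_as_gs; intros; apply gs_conv; assumption. Qed.

Lemma sapp_conv th G a (t u : tm G a) : conv t u -> conv (sapp th t) (sapp th u).
Proof. rewrite !sapp_as_gs; intros; apply gs_conv; assumption. Qed.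

Lemma pact_inst pi G a b (t : tm (a :: G) b) (u : tm G a) :
  pact pi (inst t u) = inst (pact pi t) (pact pi u).
Proof.
  rewrite !pact_as_gs, gs_inst; f_equal; apply gs_ext; [apply up_idb|].
  intros [] c n _; reflexivity.
Qed.

Lemma sapp_inst th G a b (t : tm (a :: G) b) (u : tm G a) :
  sapp th (inst t u) = inst (sapp th t) (sapp th u).
Proof.
  rewrite !sapp_as_gs, gs_inst; f_equal; apply gs_ext; [apply up_idb|].
  intros [] c n _; [apply shift_wk0|reflexivity].
Qed.

Lemma pact_rename pi G a (t : tm G a) : forall D (r : ren G D),
  pact pi (rename t r) = rename (pact pi t) r.
Proof.
  induction t; simpl; intros; try reflexivity; [rewrite IHt1, IHt2|rewrite IHt]; reflexivity.
Qed.

Lemma sapp_rename th G a (t : tm G a) : forall D (r : ren G D),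
  sapp th (rename t r) = rename (sapp th t) r.
Proof.
  induction t; simpl; intros; try reflexivity; [|rewrite IHt1, IHt2|rewrite IHt]; try reflexivity.
  unfold wk0; rewrite rename_rename; apply rename_ext; intros b m; apply (mem_nil_elim m).
Qed.

Lemma sapp_scomp th rho G a (t : tm G a) :
  sapp (scomp th rho) t = sapp rho (sapp th t).
Proof.
  induction t; simpl; try reflexivity; [|rewrite IHt1, IHt2|rewrite IHt]; try reflexivity.
  unfold wk0; rewrite sapp_rename; reflexivity.
Qed.

Lemma pact_sapp pi th G a (t : tm G a) :
  pact pi (sapp th t) = sapp (spact pi th) (pact pi t).
Proof.
  induction t; simpl; try reflexivity; [|rewrite IHt1, IHt2|rewrite IHt]; try reflexivity.
  unfold wk0; rewrite pact_rename; reflexivity.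
Qed.

(** * Group operations, transpositions and fresh permutations *)

Program Definition pid : perm sg := @Perm sg (fun _ n => n) (fun _ n => n) _ _ _.
Next Obligation. exists []; reflexivity. Qed.

Program Definition pinverse (p : perm sg) : perm sg := @Perm sg (pinv p) (pfun p) _ _ _.
Next Obligation. apply pinvK. Qed.
Next Obligation. apply pfunK. Qed.
Next Obligation.
  destruct (pfin p) as [l Hl]; exists l; intros a n H.
  rewrite <- (Hl a n H) at 1; apply pfunK.
Qed.

Program Definition pcomp (p q : perm sg) : perm sg :=
  @Perm sg (fun a n => pfun p a (pfun q a n)) (fun a n => pinv q a (pinv p a n)) _ _ _.
Next Obligation. rewrite !pfunK; reflexivity. Qed.
Next Obligation. rewrite !pinvK; reflexivity. Qed.
Next Obligation.
  destruct (pfin p) as [l Hl], (pfin q) as [l' Hl']; exists (l ++ l'); intros a n H.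
  rewrite Hl', Hl; [reflexivity| |]; intros ?; apply H, in_or_app; auto.
Qed.

Definition swap_index (a : oty) (n1 n2 : nat) (b : oty) (n : nat) : nat :=
  if excluded_middle_informative (b = a) then
    if Nat.eq_dec n n1 then n2 else if Nat.eq_dec n n2 then n1 else n
  else n.

Lemma swap_index_invol a n1 n2 b n : swap_index a n1 n2 b (swap_index a n1 n2 b n) = n.
Proof.
  unfold swap_index; destruct (excluded_middle_informative _); [|reflexivity].
  repeat destruct (Nat.eq_dec _ _); congruence.
Qed.

Program Definition pswap (a : oty) (n1 n2 : nat) : perm sg :=
  @Perm sg (swap_index a n1 n2) (swap_index a n1 n2) _ _ _.
Next Obligation. apply swap_index_invol. Qed.
Next Obligation. apply swap_index_invol. Qed.
Next Obligation.
  exists [(a, n1); (a, n2)]; intros b n H; unfold swap_index; simpl in H.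
  destruct (excluded_middle_informative _); [|reflexivity].
  destruct (Nat.eq_dec _ _); [subst; tauto|]; destruct (Nat.eq_dec _ _); [subst; tauto|reflexivity].
Qed.

Lemma pswap_l a n1 n2 : pnom (pswap a n1 n2) (a, n1) = (a, n2).
Proof.
  unfold pnom; simpl; f_equal; unfold swap_index.
  destruct (excluded_middle_informative _); [|congruence].
  destruct (Nat.eq_dec _ _); congruence.
Qed.

Lemma pswap_other a n1 n2 c : c <> (a, n1) -> c <> (a, n2) -> pnom (pswap a n1 n2) c = c.
Proof.
  destruct c as [b n]; intros H1 H2; unfold pnom; simpl; f_equal; unfold swap_index.
  destruct (excluded_middle_informative _); [subst|reflexivity].
  repeat destruct (Nat.eq_dec _ _); congruence.
Qed.

Lemma pnom_comp p q c : pnom (pcomp p q) c = pnom p (pnom q c).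
Proof. reflexivity. Qed.

Lemma pnom_inv p c : pnom (pinverse p) (pnom p c) = c.
Proof. destruct c; unfold pnom; simpl; rewrite pfunK; reflexivity. Qed.

Lemma pnom_invr p c : pnom p (pnom (pinverse p) c) = c.
Proof. destruct c; unfold pnom; simpl; rewrite pinvK; reflexivity. Qed.

Lemma pnom_inj p c d : pnom p c = pnom p d -> c = d.
Proof. intros H; rewrite <- (pnom_inv p c), H; apply pnom_inv. Qed.

(** Each step swaps the image of the new constant with an index above all those in [M] and all
    images chosen so far, so the earlier images stay put. *)
Lemma pnom_fresh_exists (L M : list nom) :
  exists p : perm sg, forall c, In c L -> ~ In (pnom p c) M.
Proof.
  induction L as [|c L [p Hp]]; [exists pid; simpl; tauto|].
  destruct (index_bound (map (fun d => (false, d)) (M ++ map (pnom p) L))) as [N HN].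
  assert (Hf : forall d, In d (M ++ map (pnom p) L) -> d <> (fst c, N)).
  { intros d Hd ->; apply (Nat.lt_irrefl N), (HN false (fst c)).
    apply (in_map (fun d => (false, d))), Hd. }
  exists (pcomp (pswap (fst c) (snd (pnom p c)) N) p).
  assert (Ec : pnom (pcomp (pswap (fst c) (snd (pnom p c)) N) p) c = (fst c, N)).
  { rewrite pnom_comp; apply (pswap_l (fst c) (snd (pnom p c)) N). }
  assert (Hc : ~ In (fst c, N) M) by (intros H; apply (Hf (fst c, N)); [apply in_or_app; auto|reflexivity]).
  intros d [<-|Hd]; [rewrite Ec; exact Hc|].
  destruct (excluded_middle_informative (c = d)) as [<-|ne]; [rewrite Ec; exact Hc|].
  rewrite pnom_comp, pswap_other; [apply Hp, Hd| |].
  - intros e; apply ne, (@pnom_inj p); symmetry; exact e.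
  - apply Hf, in_or_app; right; apply in_map, Hd.
Qed.

(** Each step swaps the current image of [c] with the wanted one. By injectivity this disturbs no
    other constant of the list, and it fixes [M] because [M] meets neither the list nor its image
    under [p]. *)
Lemma perm_extend (p : perm sg) (L : list nom) (M : nom -> Prop) :
  (forall c, In c L -> ~ M c) -> (forall c, In c L -> ~ M (pnom p c)) ->
  exists q : perm sg, (forall c, In c L -> pnom q c = pnom p c) /\
                   (forall c, M c -> pnom q c = c).
Proof.
  induction L as [|c L IH]; intros H1 H2.
  - exists pid; split; [simpl; tauto|]; intros [a n] _; reflexivity.
  - destruct IH as (q & Hq & HM); [intros; apply H1; right; assumption|
      intros; apply H2; right; assumption|].
    exists (pcomp (pswap (fst c) (snd (pnom q c)) (snd (pnom p c))) q).
    assert (Ec : pnom (pcomp (pswap (fst c) (snd (pnom q c)) (snd (pnom p c))) q) c = pnom p c).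
    { rewrite pnom_comp; exact (pswap_l (fst c) (snd (pnom q c)) (snd (pnom p c))). }
    split.
    + intros d [<-|Hd]; [exact Ec|].
      destruct (excluded_middle_informative (c = d)) as [<-|ne]; [exact Ec|].
      rewrite pnom_comp, pswap_other; [apply Hq, Hd| |].
      * intros e; apply ne, (@pnom_inj q); symmetry; exact e.
      * rewrite (Hq _ Hd); intros e; apply ne, (@pnom_inj p); symmetry; exact e.
    + intros d Hd; rewrite pnom_comp, pswap_other; [apply HM, Hd| |]; rewrite (HM _ Hd).
      * intros e; apply (H1 c); [left; reflexivity|].
        replace c with d; [exact Hd|]; apply (@pnom_inj q); rewrite (HM _ Hd); exact e.
      * intros e; apply (H2 c); [left; reflexivity|]; change (pnom p c) with (fst c, snd (pnom p c)).
        rewrite <- e; exact Hd.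
Qed.

Lemma pact_comp p q G a (t : tm G a) : pact p (pact q t) = pact (pcomp p q) t.
Proof.
  induction t; simpl; try reflexivity; [rewrite IHt1, IHt2|rewrite IHt]; reflexivity.
Qed.

Lemma pact_id G a (t : tm G a) : pact pid t = t.
Proof.
  induction t; simpl; try reflexivity; [rewrite IHt1, IHt2|rewrite IHt]; reflexivity.
Qed.

Lemma pact_inv p G a (t : tm G a) : pact (pinverse p) (pact p t) = t.
Proof.
  induction t; simpl; try reflexivity;
    [rewrite pfunK|rewrite IHt1, IHt2|rewrite IHt]; reflexivity.
Qed.

Lemma pact_invr p G a (t : tm G a) : pact p (pact (pinverse p) t) = t.
Proof.
  induction t; simpl; try reflexivity;
    [rewrite pinvK|rewrite IHt1, IHt2|rewrite IHt]; reflexivity.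
Qed.

Lemma approx_refl G a (t : tm G a) : approx t t.
Proof. exists pid; rewrite pact_id; apply conv_refl. Qed.

Lemma approx_conv G a (t u : tm G a) : conv t u -> approx t u.
Proof. exists pid; rewrite pact_id; assumption. Qed.

Lemma approx_pact p G a (t : tm G a) : approx (pact p t) t.
Proof. exists p; apply conv_refl. Qed.

Lemma approx_sym G a (t u : tm G a) : approx t u -> approx u t.
Proof.
  intros [p H]; exists (pinverse p).
  rewrite <- (pact_inv p u) at 1; apply pact_conv, conv_sym, H.
Qed.

Lemma approx_trans G a (t u v : tm G a) : approx t u -> approx u v -> approx t v.
Proof.
  intros [p H] [q H']; exists (pcomp p q); eapply conv_trans; [exact H|].
  rewrite <- pact_comp; apply pact_conv, H'.
Qed.

(** * Permutations and substitutions are determined by their action on the support *)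

Lemma pnsub_fin pi G :
  exists L, forall k b n, ~ In (k, (b, n)) L -> @pnsub pi G k b n = nm G k b n.
Proof.
  destruct (pfin pi) as [l Hl]; exists (map (fun d => (false, d)) l).
  intros [] b n H; [reflexivity|]; unfold pnsub; rewrite Hl; [reflexivity|].
  intros Hin; apply H, (in_map (fun d => (false, d))), Hin.
Qed.

Lemma snsub_fin th G :
  exists L, forall k b n, ~ In (k, (b, n)) L -> @snsub th G k b n = nm G k b n.
Proof.
  destruct (sfin th) as [l Hl]; exists (map (fun d => (true, d)) l).
  intros [] b n H; [|reflexivity]; unfold snsub; rewrite Hl; [reflexivity|].
  intros Hin; apply H, (in_map (fun d => (true, d))), Hin.
Qed.

Lemma fin_agree G (f f' : nsub G) :
  (exists L, forall k b n, ~ In (k, (b, n)) L -> f k b n = nm G k b n) ->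
  (exists L, forall k b n, ~ In (k, (b, n)) L -> f' k b n = nm G k b n) ->
  exists L, forall k b n, ~ In (k, (b, n)) L -> conv (f k b n) (f' k b n).
Proof.
  intros [L H] [L' H']; exists (L ++ L'); intros k b n Hn.
  rewrite H, H'; [apply conv_refl| |]; intros Hin; apply Hn, in_or_app; auto.
Qed.

Lemma pact_conv_supp p q G a (t : tm G a) :
  (forall c, supp t c -> pnom p c = pnom q c) -> conv (pact p t) (pact q t).
Proof.
  intros H; rewrite !pact_as_gs.
  destruct (fin_agree (pnsub_fin p G) (pnsub_fin q G)) as [L HL].
  apply gs_conv_sup with L; [|exact HL].
  intros [] b n Hs; [apply conv_refl|]; apply H in Hs; inversion Hs as [e].
  unfold pnsub; rewrite e; apply conv_refl.
Qed.

Lemma sapp_conv_fv th rho G a (t : tm G a) :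
  (forall b n, fv t (b, n) -> conv (th b n) (rho b n)) -> conv (sapp th t) (sapp rho t).
Proof.
  intros H; rewrite !sapp_as_gs.
  destruct (fin_agree (snsub_fin th G) (snsub_fin rho G)) as [L HL].
  apply gs_conv_sup with L; [|exact HL].
  intros [] b n Hs; [|apply conv_refl]; apply wk0_conv, H, Hs.
Qed.

Lemma supp_pact p G a (t : tm G a) c :
  supp (pact p t) c -> exists d, supp t d /\ c = pnom p d.
Proof.
  rewrite supp_sup, pact_as_gs; destruct (pnsub_fin p G) as [L HL].
  intros H; apply (sup_gs HL) in H; destruct H as ([] & b & n & H & H').
  - apply sup_occ in H'; contradiction.
  - exists (b, n); split; [exact H|]; apply sup_occ in H'; exact H'.
Qed.

Lemma occurs_pact p G a (t : tm G a) c :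
  occurs_nom c (pact p t) -> occurs_nom (pnom (pinverse p) c) t.
Proof.
  induction t; simpl; auto; [intros ->|intros []; auto].
  unfold pnom; simpl; rewrite pfunK; reflexivity.
Qed.

Lemma occurs_var_pact p G a (t : tm G a) x :
  occurs_var x (pact p t) -> occurs_var x t.
Proof. induction t; simpl; auto; intros []; auto. Qed.

(** A representative of [pact p t] is pulled back along the inverse permutation to a representative
    of [t]. *)
Lemma supp_pact_intro p G a (t : tm G a) c : supp t c -> supp (pact p t) (pnom p c).
Proof.
  intros H u Hu; rewrite <- (pact_invr p u).
  assert (Ho : occurs_nom c (pact (pinverse p) u)).
  { apply H; rewrite <- (pact_inv p t); apply pact_conv, Hu. }
  apply occurs_pact in Ho; rewrite pact_invr; exact Ho.
Qed.

Lemma fv_pact p G a (t : tm G a) x : fv (pact p t) x -> fv t x.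
Proof.
  rewrite !fv_sup, pact_as_gs; destruct (pnsub_fin p G) as [L HL].
  intros H; apply (sup_gs HL) in H; destruct H as ([] & b & n & H & H').
  - apply sup_occ in H'; simpl in H'; subst; exact H.
  - apply sup_occ in H'; contradiction.
Qed.

Lemma fv_approx G a (t u : tm G a) x : approx t u -> fv t x -> fv u x.
Proof. intros [p H] Hx; eapply fv_pact, fv_conv; [exact H|exact Hx]. Qed.

Lemma supp_sapp th G a (t : tm G a) c :
  supp (sapp th t) c -> supp t c \/ ssupp th c.
Proof.
  rewrite supp_sup, sapp_as_gs; destruct (snsub_fin th G) as [L HL].
  intros H; apply (sup_gs HL) in H; destruct H as ([] & b & n & H & H').
  - right; exists b, n; exact (sup_wk0 H').
  - apply sup_occ in H'; simpl in H'; subst; left; exact H.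
Qed.

Lemma fv_sapp th G a (t : tm G a) x :
  fv (sapp th t) x -> exists b n, fv t (b, n) /\ fv (th b n) x.
Proof.
  rewrite fv_sup, sapp_as_gs; destruct (snsub_fin th G) as [L HL].
  intros H; apply (sup_gs HL) in H; destruct H as ([] & b & n & H & H').
  - exists b, n; split; [exact H|exact (sup_wk0 H')].
  - apply sup_occ in H'; contradiction.
Qed.

Lemma occ_list k G a (t : tm G a) : exists L, forall c, occ k c t -> In c L.
Proof.
  destruct (occ_finite t) as [L HL]; exists (map snd L); intros c H.
  apply (in_map snd _ (k, c)), HL, H.
Qed.

Definition finite_set (P : nom -> Prop) : Prop := exists M, forall c, P c -> In c M.

Lemma occ_subst_finite k th (l : list var) :
  exists M, forall a n, In (a, n) l -> forall c, occ k c (th a n) -> In c M.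
Proof.
  induction l as [|[a n] l [M HM]]; [exists []; simpl; tauto|].
  destruct (occ_list k (th a n)) as [M' HM']; exists (M' ++ M).
  intros a' n' [e|Hin] c Hc; apply in_or_app.
  - inversion e; subst; left; apply HM', Hc.
  - right; eapply HM; eauto.
Qed.

Lemma ssupp_finite th : finite_set (ssupp th).
Proof.
  destruct (sfin th) as [l Hl]; destruct (occ_subst_finite false th l) as [M HM].
  exists M; intros c (a & n & Hc); apply supp_occurs in Hc.
  destruct (excluded_middle_informative (In (a, n) l)) as [Hin|Hin]; [exact (HM _ _ Hin _ Hc)|].
  rewrite (Hl _ _ Hin) in Hc; contradiction.
Qed.

(** * Instances of formulas *)

Lemma fresh_perm_exists (L : list nom) (P : nom -> Prop) :
  finite_set P ->
  exists p : perm sg, forall c, In c L -> ~ P (pnom p c).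
Proof.
  intros [M HM]; destruct (pnom_fresh_exists L M) as [p Hp]; exists p.
  intros c Hc Hs; exact (Hp c Hc (HM _ Hs)).
Qed.

Lemma finite_or (P Q : nom -> Prop) :
  finite_set P -> finite_set Q -> finite_set (fun c => P c \/ Q c).
Proof.
  intros [M HM] [N HN]; exists (M ++ N); intros c [H|H]; apply in_or_app; auto.
Qed.

Lemma finite_pnom (P : nom -> Prop) p : finite_set P -> finite_set (fun c => P (pnom p c)).
Proof.
  intros [M HM]; exists (map (pnom (pinverse p)) M); intros c H.
  rewrite <- (pnom_inv p c); apply in_map, HM, H.
Qed.

(** [gcs th B X]: [X] is a value of B<theta> up to [approx], so that, unlike
    for [csapp], the choice of the permutation does not matter (see [gcs_any]). *)
Definition gcs (th : subst sg) G a (B X : tm G a) : Prop :=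
  exists pi, avoids pi B th /\ approx X (sapp th (pact pi B)).

Lemma csapp_gcs th B X : csapp th B X -> gcs th B X.
Proof. intros (p & H & H'); exists p; split; [exact H|]; apply approx_conv, H'. Qed.

Lemma spact_fix p th :
  (forall c, ssupp th c -> pnom p c = c) -> sconv (spact p th) th.
Proof.
  intros H a n; simpl.
  apply conv_trans with (pact pid (th a n)); [|rewrite pact_id; apply conv_refl].
  apply pact_conv_supp; intros c Hc; rewrite H; [destruct c; reflexivity|exists a, n; exact Hc].
Qed.

(* Both [p] and [q] send the support of [B] outside the support of [th], hence
   a permutation that fixes the latter takes [q.B] to [p.B]. *)
Lemma sapp_pact_approx th G a (B : tm G a) p q :
  avoids p B th -> avoids q B th ->
  approx (sapp th (pact p B)) (sapp th (pact q B)).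
Proof.
  intros Hp Hq; destruct (occ_list false B) as [L HL].
  pose (L' := map (pnom q) (filter (fun c =>
    if excluded_middle_informative (supp B c) then true else false) L)).
  assert (HL' : forall c, supp B c -> In (pnom q c) L').
  { intros c Hc; apply in_map, filter_In; split; [apply HL, supp_occurs, Hc|].
    destruct (excluded_middle_informative _); tauto. }
  assert (HL2 : forall c, In c L' -> exists d, supp B d /\ c = pnom q d).
  { intros c Hc; apply in_map_iff in Hc; destruct Hc as (d & <- & Hd).
    apply filter_In in Hd; exists d; split; [|reflexivity].
    destruct (excluded_middle_informative _); [assumption|destruct Hd; discriminate]. }
  destruct (@perm_extend (pcomp p (pinverse q)) L' (ssupp th)) as (r & Hr & HM).
  - intros c Hc; destruct (HL2 _ Hc) as (d & Hd & ->); apply Hq, Hd.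
  - intros c Hc; destruct (HL2 _ Hc) as (d & Hd & ->).
    rewrite pnom_comp, pnom_inv; apply Hp, Hd.
  - exists r; rewrite pact_sapp.
    apply conv_trans with (sapp (spact r th) (pact p B)).
    + apply sapp_conv_fv; intros b n _; apply conv_sym, spact_fix, HM.
    + apply sapp_conv; rewrite pact_comp; apply pact_conv_supp.
      intros c Hc; rewrite pnom_comp, Hr by (apply HL', Hc).
      rewrite pnom_comp, pnom_inv; reflexivity.
Qed.

Lemma gcs_any th G a (B X : tm G a) p :
  gcs th B X -> avoids p B th -> approx X (sapp th (pact p B)).
Proof.
  intros (q & Hq & HX) Hp; eapply approx_trans; [exact HX|].
  apply sapp_pact_approx; assumption.
Qed.

Lemma gcs_unique th G a (B X Y : tm G a) : gcs th B X -> gcs th B Y -> approx X Y.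
Proof.
  intros HX (q & Hq & HY); eapply approx_trans; [|apply approx_sym, HY].
  apply gcs_any; assumption.
Qed.

Lemma gcs_approx_r th G a (B X Y : tm G a) : gcs th B X -> approx Y X -> gcs th B Y.
Proof. intros (q & Hq & HX) H; exists q; split; [exact Hq|]; eapply approx_trans; eauto. Qed.

Lemma gcs_approx_l th G a (B D X : tm G a) : gcs th B X -> approx B D -> gcs th D X.
Proof.
  intros (q & Hq & HX) [p Hp]; exists (pcomp q p); split.
  - intros c Hc; rewrite pnom_comp; apply Hq.
    apply (supp_conv (conv_sym Hp)), supp_pact_intro, Hc.
  - eapply approx_trans; [exact HX|]; apply approx_conv, sapp_conv.
    rewrite <- pact_comp; apply pact_conv, Hp.
Qed.

Lemma occ_avoids th G a (B : tm G a) p :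
  (forall c, occurs_nom c B -> ~ ssupp th (pnom p c)) -> avoids p B th.
Proof. intros H c Hc; apply H; apply supp_occurs in Hc; exact Hc. Qed.

Lemma gcs_total th G a (B : tm G a) : exists X, gcs th B X.
Proof.
  destruct (occ_list false B) as [L HL].
  destruct (fresh_perm_exists L (ssupp_finite th)) as [p Hp].
  exists (sapp th (pact p B)), p; split; [|apply approx_refl].
  apply occ_avoids; intros c Hc; apply Hp, HL, Hc.
Qed.

Lemma csapp_total th B : exists X, csapp th B X.
Proof.
  destruct (gcs_total th B) as (X & p & Hp & _); exists (sapp th (pact p B)), p.
  split; [exact Hp|apply conv_refl].
Qed.

(** A permutation that avoids the supports of both substitutions computes both instances, and these
    differ only in the values at free variables of [B]. *)
Lemma gcs_agree th rho G a (B X : tm G a) :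
  (forall b n, fv B (b, n) -> conv (th b n) (rho b n)) -> gcs th B X -> gcs rho B X.
Proof.
  intros H HX; destruct (occ_list false B) as [L HL].
  destruct (fresh_perm_exists L (finite_or (ssupp_finite th) (ssupp_finite rho))) as [p Hp].
  assert (H1 : avoids p B th) by (apply occ_avoids; intros c Hc Hs; apply (Hp c); auto).
  assert (H2 : avoids p B rho) by (apply occ_avoids; intros c Hc Hs; apply (Hp c); auto).
  exists p; split; [exact H2|]; eapply approx_trans; [apply (gcs_any HX H1)|].
  apply approx_conv, sapp_conv_fv; intros b n Hb; eapply H, fv_pact, Hb.
Qed.

(** Applying [q] to an instance permutes the substitution and the formula together, so [pcomp q p]
    computes the instance under [rho] whenever [p] computes the one under [th] and is fresh
    enough. *)
Lemma gcs_sapprox rho th G a (B X : tm G a) : sapprox rho th -> gcs th B X -> gcs rho B X.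
Proof.
  intros [q Hq] HX; destruct (occ_list false B) as [L HL].
  destruct (fresh_perm_exists L (finite_or (ssupp_finite th)
              (finite_pnom q (ssupp_finite rho)))) as [p Hp].
  assert (H1 : avoids p B th) by (apply occ_avoids; intros c Hc Hs; apply (Hp c); auto).
  exists (pcomp q p); split.
  - apply occ_avoids; intros c Hc Hs; apply (Hp c); auto.
  - eapply approx_trans; [apply (gcs_any HX H1)|].
    eapply approx_trans; [apply approx_sym, (approx_pact q)|].
    rewrite pact_sapp, pact_comp; apply approx_conv, sapp_conv_fv.
    intros; apply conv_sym, Hq.
Qed.

(** The permutation [p] is chosen so that [q], which separates [th] from [rho], can also be used to
    instantiate the intermediate formula by [rho]; then both sides apply [rho] to the same term. *)
Lemma gcs_bullet th rho ta G a (B X Y : tm G a) :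
  sbullet th rho ta -> gcs th B X -> gcs rho X Y -> gcs ta B Y.
Proof.
  intros (q & Hq & Hta) HX HY; destruct (occ_list false B) as [L HL].
  destruct (fresh_perm_exists L (finite_or (ssupp_finite th)
     (finite_pnom q (finite_or (ssupp_finite rho) (ssupp_finite ta))))) as [p Hp].
  assert (H1 : avoids p B th) by (apply occ_avoids; intros c Hc Hs; apply (Hp c); auto).
  apply (gcs_any HX) in H1; clear HX; apply (gcs_approx_l HY) in H1; clear HY X.
  exists (pcomp q p); split.
  - apply occ_avoids; intros c Hc Hs; apply (Hp c); auto.
  - assert (H2 : avoids q (sapp th (pact p B)) rho).
    { intros c Hc Hs; apply supp_sapp in Hc; destruct Hc as [Hc|(b & n & Hc)].
      - apply supp_pact in Hc; destruct Hc as (d & Hd & ->); apply supp_occurs in Hd.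
        apply (Hp d); auto.
      - apply (Hq (pnom q c)); split; [|exact Hs]; exists b, n; apply supp_pact_intro, Hc. }
    eapply approx_trans; [apply (gcs_any H1 H2)|].
    rewrite pact_sapp, pact_comp, <- sapp_scomp; apply approx_conv, sapp_conv_fv.
    intros; apply conv_sym, Hta.
Qed.

(** * Injectivity of nominal abstraction up to conversion *)

Inductive whr : forall G a, tm G a -> tm G a -> Prop :=
| whr_beta G a b (t : tm (a :: G) b) (u : tm G a) : whr (TApp (TLam t) u) (inst t u)
| whr_app G a b (t t' : tm G (Arr a b)) (u : tm G a) :
    whr t t' -> whr (TApp t u) (TApp t' u).

Inductive whrs : forall G a, tm G a -> tm G a -> Prop :=
| whrs_refl G a (t : tm G a) : whrs t t
| whrs_step G a (t u v : tm G a) : whr t u -> whrs u v -> whrs t v.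

Definition is_head G a (t : tm G a) : Prop :=
  match t with TApp _ _ | TLam _ => False | _ => True end.

(** Equality of neutral terms: the same head, with arguments compared by [conv] only. The diagonal
    [neq t t] says that [t] is neutral. *)
Inductive neq : forall G a, tm G a -> tm G a -> Prop :=
| neq_head G a (t : tm G a) : is_head t -> neq t t
| neq_app G a b (t t' : tm G (Arr a b)) (u u' : tm G a) :
    neq t t' -> conv u u' -> neq (TApp t u) (TApp t' u').

Lemma whr_app_inv G a b (t : tm G (Arr a b)) (u : tm G a) v :
  whr (TApp t u) v ->
  (exists t0, t = TLam t0 /\ v = inst t0 u) \/ (exists t', whr t t' /\ v = TApp t' u).
Proof. intros H; dependent destruction H; eauto. Qed.

Lemma whr_lam_inv G a b (t : tm (a :: G) b) v : ~ whr (TLam t) v.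
Proof. intros H; dependent destruction H. Qed.

Lemma whr_head_inv G a (t : tm G a) v : is_head t -> ~ whr t v.
Proof. intros Ht H; destruct H; exact Ht. Qed.

Lemma neq_app_inv G a b (t : tm G (Arr a b)) (u : tm G a) v :
  neq (TApp t u) v -> exists t' u', v = TApp t' u' /\ neq t t' /\ conv u u'.
Proof. intros H; dependent destruction H; [contradiction|eauto]. Qed.

Lemma neq_app_app_inv G a b (t t' : tm G (Arr a b)) (u u' : tm G a) :
  neq (TApp t u) (TApp t' u') -> neq t t' /\ conv u u'.
Proof.
  intros H; apply neq_app_inv in H; destruct H as (t0 & u0 & e & H1 & H2).
  dependent destruction e; auto.
Qed.

Lemma neq_lam_inv G a b (t : tm (a :: G) b) v : ~ neq (TLam t) v.
Proof. intros H; dependent destruction H; contradiction. Qed.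

Lemma whr_det G a (t u : tm G a) : whr t u -> forall v, whr t v -> u = v.
Proof.
  induction 1; intros v Hv; apply whr_app_inv in Hv;
    destruct Hv as [(t0 & e & ->)|(t1 & Hv & ->)].
  - dependent destruction e; reflexivity.
  - apply whr_lam_inv in Hv; contradiction.
  - subst t; apply whr_lam_inv in H; contradiction.
  - rewrite (IHwhr _ Hv); reflexivity.
Qed.

Lemma neq_whr G a (t u : tm G a) : neq t u -> forall v, ~ whr t v.
Proof.
  induction 1; intros v Hv.
  - apply whr_head_inv in Hv; assumption.
  - apply whr_app_inv in Hv; destruct Hv as [(t0 & -> & _)|(t1 & Hv & _)].
    + apply neq_lam_inv in H; exact H.
    + apply (IHneq _ Hv).
Qed.

Lemma neq_sym G a (t u : tm G a) : neq t u -> neq u t.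
Proof. induction 1; constructor; auto; apply conv_sym; assumption. Qed.

Lemma neq_trans G a (t u : tm G a) : neq t u -> forall v, neq u v -> neq t v.
Proof.
  induction 1; intros v Hv; [exact Hv|].
  apply neq_app_inv in Hv; destruct Hv as (t1 & u1 & -> & H1 & H2).
  constructor; [auto|eapply conv_trans; eauto].
Qed.

Lemma neq_conv G a (t u : tm G a) : neq t u -> conv t u.
Proof. induction 1; [apply conv_refl|apply conv_app; assumption]. Qed.

Lemma whr_conv G a (t u : tm G a) : whr t u -> conv t u.
Proof. induction 1; [apply conv_beta|apply conv_app; [assumption|apply conv_refl]]. Qed.

Lemma whrs_conv G a (t u : tm G a) : whrs t u -> conv t u.
Proof. induction 1; [apply conv_refl|eapply conv_trans; [apply whr_conv|]; eauto]. Qed.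

Lemma rename_inst G D a b (t : tm (a :: G) b) (u : tm G a) (r : ren G D) :
  rename (inst t u) r = inst (rename t (up_ren r)) (rename u r).
Proof.
  rewrite !inst_as_gs, rename_gs, gs_rename; apply gs_ext.
  - apply mem_cons_ind; reflexivity.
  - intros [] c n _; reflexivity.
Qed.

Lemma whr_rename G a (t u : tm G a) : whr t u -> forall D (r : ren G D), whr (rename t r) (rename u r).
Proof.
  induction 1; intros D r; simpl; [rewrite rename_inst|]; constructor; auto.
Qed.

Lemma whrs_rename G a (t u : tm G a) : whrs t u ->
  forall D (r : ren G D), whrs (rename t r) (rename u r).
Proof.
  induction 1; intros D r; [constructor|]; eapply whrs_step; [apply whr_rename|]; eauto.
Qed.

Lemma neq_rename G a (t u : tm G a) : neq t u -> forall D (r : ren G D), neq (rename t r) (rename u r).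
Proof.
  induction 1; intros D r; simpl; constructor; auto.
  - destruct t; simpl in *; auto.
  - apply rename_conv; assumption.
Qed.

Lemma whrs_normal G a (t u : tm G a) : whrs t u -> (forall v, ~ whr t v) -> t = u.
Proof. intros [|? ? ? v ? H _] Hn; [reflexivity|]; apply Hn in H; contradiction. Qed.

Lemma whrs_det G a (t u u' : tm G a) : whrs t u -> whrs t u' ->
  (forall v, ~ whr u v) -> (forall v, ~ whr u' v) -> u = u'.
Proof.
  intros H; revert u'; induction H; intros u' H' Hu Hu'.
  - destruct H' as [|? ? ? ? ? H1]; [reflexivity|]; apply Hu in H1; contradiction.
  - destruct H' as [|? ? ? w ? H1 H2]; [apply Hu' in H; contradiction|].
    rewrite (whr_det H H1) in *; apply IHwhrs; assumption.
Qed.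

(** At arrow types all renamings are quantified over, so that the relation survives weakening and a
    term can be applied to a new bound variable. At [O] and at base types it provides neutral weak
    head reducts with equal heads and convertible arguments. *)
Fixpoint lrel (a : ty) : forall G, tm G a -> tm G a -> Prop :=
  match a with
  | Arr a b => fun G t u => forall D (r : ren G D) v v',
      lrel v v' -> lrel (TApp (rename t r) v) (TApp (rename u r) v')
  | _ => fun G t u => exists t' u', whrs t t' /\ whrs u u' /\ neq t' u'
  end.

Lemma lrel_rename a : forall G (t u : tm G a), lrel t u ->
  forall D (r : ren G D), lrel (rename t r) (rename u r).
Proof.
  destruct a; simpl; intros G t u H D r.
  - destruct H as (t' & u' & H1 & H2 & H3); exists (rename t' r), (rename u' r).
    auto using whrs_rename, neq_rename.
  - destruct H as (t' & u' & H1 & H2 & H3); exists (rename t' r), (rename u' r).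
    auto using whrs_rename, neq_rename.
  - intros E r' v v' Hv; rewrite !rename_rename; apply H, Hv.
Qed.

Lemma lrel_whr_l a : forall G (t t' u : tm G a), whr t t' -> lrel t' u -> lrel t u.
Proof.
  induction a; simpl; intros G t t' u H H'.
  - destruct H' as (t1 & u1 & H1 & H2 & H3); exists t1, u1; split; [|auto].
    eapply whrs_step; eauto.
  - destruct H' as (t1 & u1 & H1 & H2 & H3); exists t1, u1; split; [|auto].
    eapply whrs_step; eauto.
  - intros D r v v' Hv; eapply IHa2; [apply whr_app, whr_rename, H|]; auto.
Qed.

Lemma lrel_sym a : forall G (t u : tm G a), lrel t u -> lrel u t.
Proof.
  induction a; simpl; intros G t u H.
  - destruct H as (t1 & u1 & H1 & H2 & H3); exists u1, t1; auto using neq_sym.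
  - destruct H as (t1 & u1 & H1 & H2 & H3); exists u1, t1; auto using neq_sym.
  - intros; auto.
Qed.

Lemma lrel_whr_r a G (t u u' : tm G a) : whr u u' -> lrel t u' -> lrel t u.
Proof. intros H H'; apply lrel_sym; eapply lrel_whr_l; [exact H|apply lrel_sym, H']. Qed.

Lemma lrel_trans a : forall G (t u v : tm G a), lrel t u -> lrel u v -> lrel t v.
Proof.
  assert (Hb : forall c G (t u v : tm G c),
    (exists t' u', whrs t t' /\ whrs u u' /\ neq t' u') ->
    (exists t' u', whrs u t' /\ whrs v u' /\ neq t' u') ->
    exists t' u', whrs t t' /\ whrs v u' /\ neq t' u').
  { intros c G t u v (t1 & u1 & H1 & H2 & H3) (u2 & v2 & H4 & H5 & H6).
    assert (e : u1 = u2).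
    { apply (whrs_det H2 H4); [apply (neq_whr (neq_sym H3))|apply (neq_whr H6)]. }
    subst u2; exists t1, v2; split; [exact H1|split; [exact H5|]].
    eapply neq_trans; eauto. }
  induction a; simpl; intros G t u v H H'; [eapply Hb; eauto|eapply Hb; eauto|].
  (* The middle term is applied to [w'], which is related to itself by symmetry and transitivity at
     the argument type. *)
  intros D r w w' Hw; eapply IHa2; [apply H, Hw|]; apply H'.
  eapply IHa1; [apply lrel_sym, Hw|exact Hw].
Qed.

(** The two parts need each other: at an arrow type the first reifies the argument, while the second
    applies both terms to a new bound variable, related to itself by the first, and concludes by
    eta. *)
Lemma lrel_reflect_reify a :
  (forall G (t u : tm G a), neq t u -> lrel t u) /\
  (forall G (t u : tm G a), lrel t u -> conv t u).
Proof.
  induction a as [| |a [IHa1 IHa2] b [IHb1 IHb2]]; simpl; split; intros G t u H.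
  - exists t, u; split; [apply whrs_refl|split; [apply whrs_refl|exact H]].
  - destruct H as (t1 & u1 & H1 & H2 & H3); eapply conv_trans; [apply whrs_conv, H1|].
    eapply conv_trans; [apply neq_conv, H3|apply conv_sym, whrs_conv, H2].
  - exists t, u; split; [apply whrs_refl|split; [apply whrs_refl|exact H]].
  - destruct H as (t1 & u1 & H1 & H2 & H3); eapply conv_trans; [apply whrs_conv, H1|].
    eapply conv_trans; [apply neq_conv, H3|apply conv_sym, whrs_conv, H2].
  - intros D r v v' Hv; apply IHb1, neq_app; [apply neq_rename, H|apply IHa2, Hv].
  - eapply conv_trans; [apply conv_sym, conv_eta|].
    eapply conv_trans; [|apply conv_eta]; apply conv_lam, IHb2, H, IHa1, neq_head; exact I.
Qed.

Definition lrel_sub G D (s s' : bsub G D) : Prop := forall a m, lrel (s a m) (s' a m).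

(** The contractum met when an abstraction under [s] is renamed and applied to [v] is a single
    substitution instance of the body, to which an induction hypothesis applies. *)
Lemma rename_beta G D E a b (t : tm (a :: G) b) (s : bsub G D) (r : ren D E) v :
  inst (rename (gs t (up_bsub s) (fun k c n => shift a (nm D k c n))) (up_ren r)) v =
  gs t (scons v (fun c m => rename (s c m) r)) (nm E).
Proof.
  rewrite <- (@inst_gs_up G E a b t (fun c m => rename (s c m) r) (nm E) v); f_equal.
  rewrite rename_gs; apply gs_ext.
  - apply mem_cons_ind; [reflexivity|]; intros c m; apply shift_rename.
  - intros [] c n _; reflexivity.
Qed.

Lemma rename_gs_nm G D E a (t : tm G a) (s : bsub G D) (r : ren D E) :
  rename (gs t s (nm D)) r = gs t (fun c m => rename (s c m) r) (nm E).
Proof. rewrite rename_gs; apply gs_ext; [reflexivity|]; intros [] c n _; reflexivity. Qed.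

Lemma lrel_app G a b (t t' : tm G (Arr a b)) (u u' : tm G a) :
  lrel t t' -> lrel u u' -> lrel (TApp t u) (TApp t' u').
Proof.
  intros H H'; specialize (H G (fun _ m => m) u u' H').
  rewrite !rename_id in H; auto.
Qed.

Lemma lrel_scons G D a (s s' : bsub G D) (u u' : tm D a) :
  lrel u u' -> lrel_sub s s' -> lrel_sub (scons u s) (scons u' s').
Proof. intros Hu Hs; unfold lrel_sub; apply mem_cons_ind; [exact Hu|intros; apply Hs]. Qed.

Lemma lrel_sub_rename G D E (s s' : bsub G D) (r : ren D E) :
  lrel_sub s s' -> lrel_sub (fun c m => rename (s c m) r) (fun c m => rename (s' c m) r).
Proof. intros H c m; apply lrel_rename, H. Qed.

Lemma lrel_refl G a (t : tm G a) : forall D (s s' : bsub G D),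
  lrel_sub s s' -> lrel (gs t s (nm D)) (gs t s' (nm D)).
Proof.
  induction t; intros D s s' Hs;
    try (apply lrel_reflect_reify, neq_head; exact I).
  - apply Hs.
  - apply lrel_app; auto.
  - intros E r v v' Hv; simpl.
    eapply lrel_whr_l; [apply whr_beta|]; eapply lrel_whr_r; [apply whr_beta|].
    rewrite !rename_beta; apply IHt, lrel_scons; [exact Hv|apply lrel_sub_rename, Hs].
Qed.

(** Fundamental theorem. Beta holds by closure under weak head expansion, and eta because at arrow
    types terms are observed only through application. Names are heads and stand for themselves, so
    only bound variables are substituted. *)
Lemma lrel_conv G a (t u : tm G a) : conv t u -> forall D (s s' : bsub G D),
  lrel_sub s s' -> lrel (gs t s (nm D)) (gs u s' (nm D)).
Proof.
  induction 1; intros D s s' Hs.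
  - apply lrel_refl, Hs.
  - apply lrel_sym, IHconv; intros c m; apply lrel_sym, Hs.
  - eapply lrel_trans; [apply IHconv1|apply IHconv2, Hs].
    intros c m; eapply lrel_trans; [apply Hs|apply lrel_sym, Hs].
  - apply lrel_app; auto.
  - intros E r v v' Hv; simpl.
    eapply lrel_whr_l; [apply whr_beta|]; eapply lrel_whr_r; [apply whr_beta|].
    rewrite !rename_beta; apply IHconv, lrel_scons; [exact Hv|apply lrel_sub_rename, Hs].
  - rewrite gs_inst, inst_gs_up; eapply lrel_whr_l; [apply whr_beta|].
    rewrite inst_gs_up; apply lrel_refl, lrel_scons; [apply lrel_refl, Hs|exact Hs].
  - intros E r v v' Hv; cbn [gs rename].
    eapply lrel_whr_l; [apply whr_beta|].
    pose proof (@rename_beta G D E a b (TApp (shift a t) (TBound (here G a))) s r v) as e.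
    cbn [gs rename] in e; cbn [rename]; rewrite e, gs_shift, <- rename_gs_nm.
    apply lrel_app; [apply lrel_rename, lrel_refl, Hs|exact Hv].
Qed.

(** Neutral terms have no weak head reduct, so the neutral reducts provided by the logical relation
    at type [O] are [t] and [u] themselves. *)
Lemma conv_neutral (t u : form sg) : neq t t -> neq u u -> conv t u -> neq t u.
Proof.
  intros Ht Hu H; apply lrel_conv with (s := @idb []) (s' := @idb []) in H.
  2: intros c m; apply (mem_nil_elim m).
  rewrite !gs_id in H; try reflexivity.
  destruct H as (t' & u' & H1 & H2 & H3).
  rewrite (whrs_normal H1 (neq_whr Ht)), (whrs_normal H2 (neq_whr Hu)); exact H3.
Qed.

Lemma neq_log_app a b (K : logic (Arr a b)) (u : tm [] a) :
  neq (TApp (TLog [] K) u) (TApp (TLog [] K) u).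
Proof. apply neq_app; [apply neq_head; exact I|apply conv_refl]. Qed.

Lemma nabs_inj l b (s s' : tm [] (arrows l b)) (t t' : tm [] b) :
  conv (nabs s t) (nabs s' t') -> conv s s' /\ conv t t'.
Proof.
  intros H; apply conv_neutral in H;
    try (apply neq_app; [apply neq_log_app|apply conv_refl]).
  apply neq_app_app_inv in H; destruct H as [H Ht].
  apply neq_app_app_inv in H; tauto.
Qed.

(** Weakening the abstraction and applying it to the new bound variable gives back the body. *)
Lemma lam_inj a b (t u : tm [a] b) : conv (TLam t) (TLam u) -> conv t u.
Proof.
  assert (E : forall v : tm [a] b,
    conv v (TApp (shift a (TLam v)) (TBound (here [] a)))).
  { intros v; eapply conv_trans; [|apply conv_sym, conv_beta].
    rewrite inst_as_gs, gs_rename, gs_id; [apply conv_refl| |reflexivity].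
    apply mem_cons_ind; reflexivity. }
  intros H; eapply conv_trans; [apply E|]; eapply conv_trans; [|apply conv_sym, E].
  apply conv_app; [apply rename_conv, H|apply conv_refl].
Qed.

(** If [x] were missing from a representative of the quantified formula, renaming [x] would preserve
    that formula up to conversion, and hence by injectivity also its body; but the renamed body does
    not contain [x]. *)
Lemma fv_quantified a (K : logic (Arr (Arr a O) O)) (B : tm [a] O) x :
  fv B x -> fv (TApp (TLog [] K) (TLam B)) x.
Proof.
  intros Hx; apply NNPP; intros Hn; apply (@not_sup true) in Hn.
  destruct Hn as (u & Hu & Ho); destruct x as [b n].
  (* Any index other than [n] serves: only the disappearance of [n] matters. *)
  pose (f := @replace_index true b n (S n) []).
  pose (B' := gs B (up_bsub (@idb [])) (fun k c m => shift a (f k c m))).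
  assert (Hc : conv (TApp (TLog [] K) (TLam B)) (TApp (TLog [] K) (TLam B'))).
  { eapply conv_trans; [exact Hu|].
    apply conv_trans with (gs u (@idb []) f); [|apply (gs_conv (conv_sym Hu))].
    rewrite gs_id; [apply conv_refl|reflexivity|].
    intros k c m Hm; unfold f, replace_index.
    destruct (excluded_middle_informative _) as [e|e]; [|reflexivity].
    inversion e; subst; contradiction. }
  apply conv_neutral in Hc; try apply neq_log_app.
  apply neq_app_app_inv in Hc; destruct Hc as [_ Hc]; apply lam_inj, Hx in Hc.
  apply (@occ_gs true) in Hc; destruct Hc as [(c & m & Hc)|(k & c & m & _ & Hc)].
  - revert c m Hc; refine (@mem_cons_ind a [] (fun c m => occ true (b, n) (up_bsub (@idb []) m) -> False) _ _); auto.
  - apply occ_rename in Hc; unfold f, replace_index in Hc.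
    destruct (excluded_middle_informative _) as [e|e];
      apply occ_nm in Hc; destruct Hc as [<- Hc]; inversion Hc; subst.
    + inversion e; lia.
    + congruence.
Qed.

(** * Nominal abstraction *)

(** The value of [abs_nom] at a constant given as one variable [d], which lets the equation in the
    cast be destructed. *)
Definition abs_name (c d : nom) G : tm (G ++ [oty_ty (fst c)]) (fst d) :=
  match excluded_middle_informative (c = d) with
  | left e => eq_rect c (fun d => tm (G ++ [oty_ty (fst c)]) (fst d))
                (TBound (mem_last (oty_ty (fst c)) G)) d e
  | right _ => TNom _ (fst d) (snd d)
  end.

Definition abs_nsub (c : nom) G : nsub (G ++ [oty_ty (fst c)]) :=
  fun k a n => if k then TVar _ a n else @abs_name c (a, n) G.

Lemma shift_abs_name (c d : nom) G b :
  shift b (abs_name c d G) = abs_name c d (b :: G).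
Proof.
  unfold abs_name; destruct (excluded_middle_informative _) as [e|e]; [|reflexivity].
  destruct e; reflexivity.
Qed.

Lemma abs_name_same (c : nom) G : abs_name c c G = TBound (mem_last (oty_ty (fst c)) G).
Proof.
  unfold abs_name; destruct (excluded_middle_informative _) as [e|e]; [|congruence].
  rewrite <- eq_rect_eq; reflexivity.
Qed.

Lemma abs_name_other (c d : nom) G : c <> d -> abs_name c d G = TNom _ (fst d) (snd d).
Proof.
  intros H; unfold abs_name.
  destruct (excluded_middle_informative _) as [e|e]; [contradiction|reflexivity].
Qed.

Lemma abs_nom_as_gs c G a (t : tm G a) :
  abs_nom c t = gs t (fun b m => TBound (mem_weak [oty_ty (fst c)] m)) (@abs_nsub c G).
Proof.
  induction t; simpl; try reflexivity.
  - rewrite IHt1, IHt2; reflexivity.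
  - f_equal; rewrite IHt; apply gs_ext.
    + apply mem_cons_ind; reflexivity.
    + intros [] d n _; [reflexivity|]; symmetry; exact (shift_abs_name c (d, n) G a).
Qed.

Lemma abs_nom_conv c G a (t u : tm G a) : conv t u -> conv (abs_nom c t) (abs_nom c u).
Proof. rewrite !abs_nom_as_gs; intros; apply gs_conv; assumption. Qed.

Lemma occ_abs_nom k x c G a (t : tm G a) :
  occ k x (abs_nom c t) -> occ k x t /\ (k, x) <> (false, c).
Proof.
  rewrite abs_nom_as_gs; intros H; apply occ_gs in H.
  destruct H as [(b & m & H)|([] & b & n & H & H')]; [destruct k; contradiction| |].
  - apply (@occ_nm k x _ true) in H'; destruct H' as [-> ->]; split; [exact H|congruence].
  - unfold abs_nsub in H'.
    destruct (excluded_middle_informative (c = (b, n))) as [->|ne].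
    + rewrite abs_name_same in H'; destruct k; contradiction.
    + rewrite abs_name_other in H' by exact ne.
      apply (@occ_nm k x _ false) in H'; destruct H' as [-> ->]; split; [exact H|].
      intros e; apply ne; injection e; auto.
Qed.

Lemma abs_nom_fresh c G a (t : tm G a) : ~ occurs_nom c t ->
  abs_nom c t = rename t (fun b m => mem_weak [oty_ty (fst c)] m).
Proof.
  intros H; rewrite abs_nom_as_gs, rename_as_gs; apply gs_ext; [reflexivity|].
  intros [] b n Ho; [reflexivity|]; apply (@abs_name_other c (b, n)); intros ->; exact (H Ho).
Qed.

Lemma inst_abs_nom c a (t : tm [] a) : inst (abs_nom c t) (TNom [] (fst c) (snd c)) = t.
Proof.
  rewrite inst_as_gs, abs_nom_as_gs, gs_gs; apply gs_id.
  - intros b m; apply (mem_nil_elim m).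
  - intros [] b n _; [reflexivity|]; unfold abs_nsub.
    destruct (excluded_middle_informative (c = (b, n))) as [->|ne].
    + rewrite abs_name_same; reflexivity.
    + rewrite abs_name_other by exact ne; reflexivity.
Qed.

(** Only up to conversion: a term in the range of [th] may mention [c] outside its support, and a
    representative without [c] has to be taken. *)
Lemma sapp_abs_nom th c G a (t : tm G a) :
  ~ ssupp th c -> conv (sapp th (abs_nom c t)) (abs_nom c (sapp th t)).
Proof.
  intros Hc; rewrite !sapp_as_gs, !abs_nom_as_gs, !gs_gs.
  apply gs_conv_ext; [intros; apply conv_refl|].
  intros [] b n _; simpl.
  - rewrite <- abs_nom_as_gs.
    assert (Hs : ~ sup false c (th b n)) by (intros H; apply Hc; exists b, n; exact H).
    destruct (not_sup Hs) as (u & H1 & H2).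
    eapply conv_trans; [apply wk0_conv, H1|].
    eapply conv_trans; [|apply conv_sym, abs_nom_conv, wk0_conv, H1].
    rewrite abs_nom_fresh by (intros Ho; apply (@occ_rename false) in Ho; exact (H2 Ho)).
    unfold wk0; rewrite rename_rename.
    erewrite rename_ext; [apply conv_refl|]; intros d m; apply (mem_nil_elim m).
  - unfold abs_nsub; destruct (excluded_middle_informative (c = (b, n))) as [->|ne].
    + rewrite abs_name_same; apply conv_refl.
    + rewrite abs_name_other by exact ne; apply conv_refl.
Qed.

Lemma pact_abs_nom p c G a (t : tm G a) :
  pact p (abs_nom c t) = abs_nom (pnom p c) (pact p t).
Proof.
  rewrite !pact_as_gs, !abs_nom_as_gs, !gs_gs; apply gs_ext; [reflexivity|].
  intros [] b n _; [reflexivity|].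
  change (gs (abs_name c (b, n) G) (@idb _) (@pnsub p _)
          = abs_name (pnom p c) (pnom p (b, n)) G).
  destruct (excluded_middle_informative (c = (b, n))) as [->|ne].
  - rewrite !abs_name_same; reflexivity.
  - rewrite !abs_name_other; [reflexivity| |exact ne].
    intros e; apply ne, (pnom_inj e).
Qed.

Lemma nlams_conv cs b (t u : tm [] b) : conv t u -> conv (nlams cs t) (nlams cs u).
Proof.
  intros H; induction cs as [|c cs IH]; simpl; [exact H|].
  apply conv_lam; exact (abs_nom_conv c IH).
Qed.

Lemma sapp_nlams th cs b (t : tm [] b) : (forall c, In c cs -> ~ ssupp th c) ->
  conv (sapp th (nlams cs t)) (nlams cs (sapp th t)).
Proof.
  induction cs as [|c cs IH]; simpl; intros H; [apply conv_refl|].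
  apply conv_lam; eapply conv_trans.
  - exact (sapp_abs_nom (nlams cs t) (H c (or_introl eq_refl))).
  - refine (abs_nom_conv c (IH _)); auto.
Qed.

Lemma occ_nlams k x cs b (t : tm [] b) :
  occ k x (nlams cs t) -> occ k x t /\ (k = false -> ~ In x cs).
Proof.
  induction cs as [|c cs IH]; simpl; intros H; [auto|].
  assert (H' : occ k x (abs_nom c (nlams cs t))) by (destruct k; exact H).
  destruct (occ_abs_nom (G := []) H') as [H1 H2]; apply IH in H1; destruct H1 as [H1 H3].
  split; [exact H1|]; intros -> [->|Hin]; [exact (H2 eq_refl)|exact (H3 eq_refl Hin)].
Qed.

(** The list of types of [map (pnom p) cs] is only propositionally equal to that
    of [cs], hence the transport. *)
Lemma pact_nlams p cs b (t : tm [] b) :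
  exists e : map fst (map (pnom p) cs) = map fst cs,
    eq_rect _ (fun l => tm [] (arrows (tys l) b)) (nlams (map (pnom p) cs) (pact p t)) _ e
    = pact p (nlams cs t).
Proof.
  induction cs as [|c cs [e IH]]; simpl; [exists eq_refl; reflexivity|].
  exists (f_equal (cons (fst c)) e).
  pose proof (@pact_abs_nom p c [] _ (nlams cs t)) as E; simpl in E.
  rewrite E, <- IH; clear E IH.
  generalize (nlams (map (pnom p) cs) (pact p t)); revert e.
  generalize (map fst cs) as l; intros l e; destruct e; reflexivity.
Qed.

(** [nabs_holds] with a property of the abstracted constants on record. They are absent from the
    support of [s], yet must be moved away from the support of a substitution before it can pass
    under the abstractions. *)
Inductive nabs_by (P : nom -> Prop) : forall l b, tm [] (arrows l b) -> tm [] b -> Prop :=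
| NabsBy (cs : list nom) b (s : tm [] (arrows (tys (map fst cs)) b)) (t : tm [] b) :
    NoDup cs -> (forall c, In c cs -> P c) -> conv s (nlams cs t) -> nabs_by P s t.

Lemma nabs_holds_by l b (s : tm [] (arrows l b)) t :
  nabs_holds s t -> exists cs, nabs_by (fun c => In c cs) s t.
Proof. intros [cs c s' t' H1 H2]; exists cs; apply NabsBy; auto. Qed.

Lemma nabs_by_holds P l b (s : tm [] (arrows l b)) t : nabs_by P s t -> nabs_holds s t.
Proof. intros [cs c s' t' H1 H2 H3]; apply NabsHolds; auto. Qed.

Lemma nabs_holds_conv l b (s s' : tm [] (arrows l b)) t t' :
  conv s s' -> conv t t' -> nabs_holds s t -> nabs_holds s' t'.
Proof.
  intros Hs Ht H; revert s' t' Hs Ht; destruct H as [cs c s t H1 H2]; intros s' t' Hs Ht.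
  apply NabsHolds; [exact H1|]; eapply conv_trans; [apply conv_sym, Hs|].
  eapply conv_trans; [exact H2|apply nlams_conv, Ht].
Qed.

Lemma nabs_by_pact (P Q : nom -> Prop) p l b (s : tm [] (arrows l b)) t :
  (forall c, P c -> Q (pnom p c)) -> nabs_by P s t -> nabs_by Q (pact p s) (pact p t).
Proof.
  intros HPQ [cs c s' t' H1 H2 H3]; destruct (pact_nlams p cs t') as [e E].
  apply (pact_conv p) in H3; rewrite <- E in H3; clear E.
  assert (H4 : NoDup (map (pnom p) cs)).
  { apply FinFun.Injective_map_NoDup; [intros x y; apply pnom_inj|exact H1]. }
  assert (H5 : forall d, In d (map (pnom p) cs) -> Q d).
  { intros d Hd; apply in_map_iff in Hd; destruct Hd as (d' & <- & Hd); auto. }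
  clear H1 H2; revert e H3 H4 H5; generalize (pact p s') (map (pnom p) cs).
  clear s'; generalize (map fst cs) as l'; intros l' s' cs' e; destruct e; simpl.
  intros H3 H4 H5; apply NabsBy; assumption.
Qed.

Lemma nabs_holds_pact p l b (s : tm [] (arrows l b)) t :
  nabs_holds s t -> nabs_holds (pact p s) (pact p t).
Proof.
  intros H; destruct (nabs_holds_by H) as [cs H'].
  eapply nabs_by_holds, (@nabs_by_pact _ (fun _ => True)); [|exact H']; auto.
Qed.

Lemma nabs_by_sapp th l b (s : tm [] (arrows l b)) t :
  nabs_by (fun c => ~ ssupp th c) s t -> nabs_holds (sapp th s) (sapp th t).
Proof.
  intros [cs c s' t' H1 H2 H3]; apply NabsHolds; [exact H1|].
  eapply conv_trans; [apply sapp_conv, H3|apply sapp_nlams, H2].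
Qed.

(** Through [gcs], being a solution no longer depends on the chosen permutation. Backwards, an
    instance of the whole formula known up to [approx] is split into instances of [s] and [t] by
    [nabs_inj]. *)
Lemma solution_gcs l b (s : tm [] (arrows l b)) t th :
  solution s t th <->
  exists (s' : tm [] (arrows l b)) t', gcs th (nabs s t) (nabs s' t') /\ nabs_holds s' t'.
Proof.
  split.
  - intros (p & Hp & H); exists (sapp th (pact p s)), (sapp th (pact p t)); split; [|exact H].
    exists p; split; [exact Hp|apply approx_refl].
  - intros (s' & t' & (p & Hp & [q Hq]) & H); exists p; split; [exact Hp|].
    apply nabs_inj in Hq; destruct Hq as [H1 H2].
    apply (nabs_holds_conv H1 H2), (nabs_holds_pact (pinverse q)) in H.
    rewrite !pact_inv in H; exact H.
Qed.

(** * Raising *)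

Fixpoint map_args G D (f : forall a, tm G a -> tm D a) (l : list ty) : args G l -> args D l :=
  match l return args G l -> args D l with
  | [] => fun _ => tt
  | a :: l => fun us => (f a (fst us), map_args f (snd us))
  end.

Lemma pact_apps p G l b (t : tm G (arrows l b)) (us : args G l) :
  pact p (apps t us) = apps (pact p t) (map_args (pact p (G := G)) us).
Proof. induction l; simpl in *; [reflexivity|]; rewrite IHl; reflexivity. Qed.

Lemma sapp_apps th G l b (t : tm G (arrows l b)) (us : args G l) :
  sapp th (apps t us) = apps (sapp th t) (map_args (sapp th (G := G)) us).
Proof. induction l; simpl in *; [reflexivity|]; rewrite IHl; reflexivity. Qed.

Lemma apps_conv G l b (t t' : tm G (arrows l b)) (us : args G l) :
  conv t t' -> conv (apps t us) (apps t' us).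
Proof.
  induction l; simpl; intros H; [exact H|]; apply IHl, conv_app; [exact H|apply conv_refl].
Qed.

(** Beta undoes the abstraction; an abstraction over [cs] is thus a value for a raised variable that
    yields a prescribed term on the arguments [cs]. *)
Lemma apps_nlams cs b (t : tm [] b) : conv (apps (nlams cs t) (nom_args [] cs)) t.
Proof.
  induction cs as [|c cs IH]; simpl; [apply conv_refl|].
  eapply conv_trans; [|exact IH]; apply apps_conv.
  eapply conv_trans; [apply conv_beta|]; rewrite inst_abs_nom; apply conv_refl.
Qed.

Lemma sapp_pact_nom_args th p cs :
  map_args (sapp th (G := [])) (map_args (pact p (G := [])) (nom_args [] cs))
  = map_args (pact p (G := [])) (nom_args [] cs).
Proof. induction cs as [|c cs IH]; simpl; [|rewrite IH]; reflexivity. Qed.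

Lemma occ_raise k x cs a n : occ k x (raise cs a n) ->
  (k, x) = (true, (raised cs a, n)) \/ k = false /\ In x cs.
Proof.
  assert (H : forall (t : tm [] (arrows (tys (map fst cs)) a)),
    occ k x (apps t (nom_args [] cs)) -> occ k x t \/ k = false /\ In x cs).
  { induction cs as [|c cs IH]; simpl; intros t H; [auto|].
    apply IH in H; destruct H as [H|[-> H]]; [|auto].
    destruct k; simpl in H; [tauto|]; destruct H as [H|H]; [auto|].
    subst; destruct c; auto. }
  intros Ho; apply H in Ho; destruct Ho as [Ho|Ho]; [left|auto].
  destruct k; simpl in Ho; [subst; reflexivity|contradiction].
Qed.

(** * Redefining a substitution at one variable *)

Definition update_fun th (h : var) (T : tm [] (fst h)) (a : oty) (n : nat) : tm [] a :=
  match excluded_middle_informative (h = (a, n)) with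
  | left e => eq_rect h (fun d => tm [] (fst d)) T (a, n) e
  | right _ => th a n
  end.

Lemma update_fin th (h : var) (T : tm [] (fst h)) :
  exists l : list var, forall a n, ~ In (a, n) l -> update_fun th T a n = TVar [] a n.
Proof.
  destruct (sfin th) as [l Hl]; exists (h :: l); intros a n H; unfold update_fun.
  destruct (excluded_middle_informative _) as [e|e]; [subst; simpl in H; tauto|].
  apply Hl; intros Hin; apply H; right; exact Hin.
Qed.

Definition update th (h : var) (T : tm [] (fst h)) : subst sg := Subst (update_fin th T).

Lemma update_same th (a : oty) n (T : tm [] a) : update th (h := (a, n)) T a n = T.
Proof.
  simpl; unfold update_fun; destruct (excluded_middle_informative _) as [e|e]; [|congruence].
  rewrite <- eq_rect_eq; reflexivity.
Qed.

Lemma update_other th h T a n : h <> (a, n) -> update th (h := h) T a n = th a n.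
Proof.
  intros H; simpl; unfold update_fun.
  destruct (excluded_middle_informative _) as [e|e]; [contradiction|reflexivity].
Qed.

(** * Sequents *)


Lemma Forall2_conv_refl (l : list (form sg)) : Forall2 (@conv sg [] O) l l.
Proof. induction l; constructor; [apply conv_refl|assumption]. Qed.

Lemma seq_eq_refl (q : sequent sg) : seq_eq q q.
Proof.
  split; [tauto|split; [|apply conv_refl]].
  exists (hyps q); split; [apply Permutation_refl|apply Forall2_conv_refl].
Qed.

Lemma Permutation_Forall2_r A B (P : A -> B -> Prop) l l1 l1' :
  Forall2 P l l1 -> Permutation l1 l1' ->
  exists l', Permutation l l' /\ Forall2 P l' l1'.
Proof.
  intros H HP; apply Forall2_flip in H.
  destruct (Permutation_Forall2 HP H) as (l' & H1 & H2).
  exists l'; split; [exact H1|apply Forall2_flip, H2].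
Qed.

Lemma seq_eq_trans (q q' q'' : sequent sg) : seq_eq q q' -> seq_eq q' q'' -> seq_eq q q''.
Proof.
  intros (H1 & (G & H2 & H3) & H4) (K1 & (G' & K2 & K3) & K4); split; [|split].
  - intros x; rewrite H1; apply K1.
  - destruct (Permutation_Forall2_r H3 K2) as (G'' & L1 & L2); exists G''; split.
    + eapply Permutation_trans; eauto.
    + clear - K3 L2; revert K3; generalize (hyps q'') as l.
      induction L2; intros l0 K; inversion K; subst; constructor; auto.
      eapply conv_trans; eauto.
  - eapply conv_trans; eauto.
Qed.

Lemma Forall2_in_l A B (P : A -> B -> Prop) l l' x :
  Forall2 P l l' -> In x l -> exists y, In y l' /\ P x y.
Proof.
  induction 1; simpl; [tauto|]; intros [->|Hin]; [eauto|].
  destruct (IHForall2 Hin) as (z & Hz & Hp); eauto.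
Qed.

Lemma Forall2_in_r A B (P : A -> B -> Prop) l l' y :
  Forall2 P l l' -> In y l' -> exists x, In x l /\ P x y.
Proof. intros H; apply Forall2_flip in H; apply (Forall2_in_l H). Qed.

Lemma Forall2_impl_in A B (P Q : A -> B -> Prop) l l' :
  (forall x y, In x l -> In y l' -> P x y -> Q x y) -> Forall2 P l l' -> Forall2 Q l l'.
Proof. intros HPQ H; induction H; constructor; simpl in *; auto. Qed.

Lemma sequent_ok_seq_eq (q q' : sequent sg) : seq_eq q q' -> sequent_ok q' -> sequent_ok q.
Proof.
  intros (H1 & (G & H2 & H3) & H4) ((l & K1) & K2 & K3); split; [|split].
  - exists l; intros x Hx; apply K1, H1, Hx.
  - intros B HB x Hx; apply H1; apply (Permutation_in _ H2) in HB.
    destruct (Forall2_in_l H3 HB) as (B' & HB' & Hc).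
    apply (K2 _ HB'), (fv_conv Hc), Hx.
  - intros x Hx; apply H1, K3, (fv_conv H4), Hx.
Qed.

Lemma derivable_ok R (q : sequent sg) : derivable R q -> sequent_ok q.
Proof. intros []; assumption. Qed.

Lemma derivable_seq_eq R (q q' : sequent sg) :
  derivable R q -> seq_eq q q' -> sequent_ok q' -> derivable R q'.
Proof.
  intros [P q0 q1 HR He Hok HP] He' Hok'.
  apply (Derive HR); [eapply seq_eq_trans; eauto|exact Hok'|exact HP].
Qed.

Lemma derivable_rule (R : rule sg) (P : sequent sg -> Prop) (q : sequent sg) :
  R P q -> sequent_ok q -> (forall r, P r -> derivable R r) -> derivable R q.
Proof. intros H Hok HP; apply (Derive H (seq_eq_refl q) Hok HP). Qed.

Lemma derivable_core defs (L : rule sg) ps (q : sequent sg) :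
  core defs (prem ps) q -> sequent_ok q ->
  (forall r, In r ps -> derivable (logic_with defs L) r) -> derivable (logic_with defs L) q.
Proof. intros H; apply derivable_rule; left; exact H. Qed.

Lemma derivable_approx_hyp defs (L : rule sg) Sig Ga X Y C :
  approx X Y -> sequent_ok (Seq Sig (X :: Ga) C) ->
  derivable (logic_with defs L) (Seq Sig (Y :: Ga) C) ->
  derivable (logic_with defs L) (Seq Sig (X :: Ga) C).
Proof.
  intros Ha Hok HY.
  apply (derivable_core (r_cut defs Sig [X] Ga Y C) Hok).
  intros p [<-|[<-|[]]]; [|exact HY].
  destruct Hok as (H1 & H2 & _).
  assert (HX : forall x, fv X x -> Sig x) by (intros x; apply (H2 X); left; reflexivity).
  apply (derivable_core (r_id defs Sig [] Ha)); [|simpl; tauto].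
  split; [exact H1|split].
  - intros B [<-|[]]; exact HX.
  - intros x Hx; apply HX, (fv_approx (approx_sym Ha)), Hx.
Qed.

Lemma derivable_approx_goal defs (L : rule sg) Sig Ga C D :
  approx D C -> sequent_ok (Seq Sig Ga C) ->
  derivable (logic_with defs L) (Seq Sig Ga D) ->
  derivable (logic_with defs L) (Seq Sig Ga C).
Proof.
  intros Ha Hok HD.
  rewrite <- (app_nil_r Ga) in Hok |- *.
  apply (derivable_core (r_cut defs Sig Ga [] D C) Hok).
  intros p [<-|[<-|[]]]; [exact HD|].
  destruct Hok as (H1 & _ & H3).
  apply (derivable_core (r_id defs Sig [] Ha)); [|simpl; tauto].
  split; [exact H1|split; [|exact H3]].
  intros B [<-|[]] x Hx; apply H3, (fv_approx Ha), Hx.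
Qed.

Lemma sequent_ok_approx_hyp (Sig : ctx sg) Ga X Y C :
  approx X Y -> sequent_ok (Seq Sig (X :: Ga) C) -> sequent_ok (Seq Sig (Y :: Ga) C).
Proof.
  intros Ha (H1 & H2 & H3); split; [exact H1|split; [|exact H3]].
  intros B [<-|HB] x Hx; [|apply (H2 B); [right; exact HB|exact Hx]].
  apply (H2 X); [left; reflexivity|]; apply (fv_approx (approx_sym Ha)), Hx.
Qed.

Lemma sequent_ok_approx_goal (Sig : ctx sg) Ga C D :
  approx C D -> sequent_ok (Seq Sig Ga C) -> sequent_ok (Seq Sig Ga D).
Proof.
  intros Ha (H1 & H2 & H3); split; [exact H1|split; [exact H2|]].
  intros x Hx; apply H3, (fv_approx (approx_sym Ha)), Hx.
Qed.

(** The principal formula of an instance is known only up to [approx]; the rule is applied to a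
    representative [Y] of the right shape and a cut absorbs the difference. *)
Lemma derivable_core_left defs (L : rule sg) ps Sig Ga X Y C :
  core defs (prem ps) (Seq Sig (Y :: Ga) C) ->
  approx X Y -> sequent_ok (Seq Sig (X :: Ga) C) ->
  (forall r, In r ps -> derivable (logic_with defs L) r) ->
  derivable (logic_with defs L) (Seq Sig (X :: Ga) C).
Proof.
  intros H Ha Hok HP; apply (derivable_approx_hyp Ha Hok).
  apply (derivable_core H); [|exact HP]; apply (sequent_ok_approx_hyp Ha Hok).
Qed.

Lemma derivable_core_right defs (L : rule sg) ps Sig Ga C D :
  core defs (prem ps) (Seq Sig Ga D) ->
  approx C D -> sequent_ok (Seq Sig Ga C) ->
  (forall r, In r ps -> derivable (logic_with defs L) r) ->
  derivable (logic_with defs L) (Seq Sig Ga C).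
Proof.
  intros H Ha Hok HP; apply (derivable_approx_goal (approx_sym Ha) Hok).
  apply (derivable_core H); [|exact HP]; apply (sequent_ok_approx_goal Ha Hok).
Qed.

Lemma fv_gcs th (B X : form sg) x :
  gcs th B X -> fv X x -> exists b n, fv B (b, n) /\ fv (th b n) x.
Proof.
  intros (p & _ & Ha) Hx; apply (fv_approx Ha), fv_sapp in Hx.
  destruct Hx as (b & n & H1 & H2); exists b, n; split; [eapply fv_pact, H1|exact H2].
Qed.

(** An inclusion in place of the equation between [Sig'] and [ctx_sub Sig th]; it suffices for
    instances to be well formed over [Sig']. *)
Definition maps_ctx th (Sig Sig' : ctx sg) : Prop :=
  forall b n, Sig (b, n) -> forall y, fv (th b n) y -> Sig' y.

Lemma sequent_ok_gcs th (q : sequent sg) Sig' Hs C :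
  sequent_ok q -> (exists l : list var, forall x, Sig' x -> In x l) ->
  maps_ctx th (sctx q) Sig' -> Forall2 (@gcs th [] O) (hyps q) Hs ->
  gcs th (goal q) C -> sequent_ok (Seq Sig' Hs C).
Proof.
  intros (_ & H2 & H3) Hfin Hm HH HC; split; [exact Hfin|split].
  - intros X HX x Hx; destruct (Forall2_in_r HH HX) as (B & HB & Hg).
    destruct (fv_gcs Hg Hx) as (b & n & K1 & K2); apply (Hm b n); [|exact K2].
    apply (H2 B); assumption.
  - intros x Hx; destruct (fv_gcs HC Hx) as (b & n & K1 & K2).
    apply (Hm b n); [apply H3|]; assumption.
Qed.

Lemma seq_instance_ok th Sig Ga C (q : sequent sg) :
  sequent_ok (Seq Sig Ga C) -> seq_instance th Sig Ga C q -> sequent_ok q.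
Proof.
  intros Hok (H1 & H2 & H3); destruct q as [Sig' Hs D]; simpl in *.
  eapply sequent_ok_gcs; [exact Hok| | |simpl|apply csapp_gcs, H3].
  - destruct Hok as ((l & Hl) & _); destruct (sfin th) as [l' Hl'].
    destruct (occ_subst_finite true th l') as [M HM]; exists (l ++ M); intros x Hx.
    apply in_or_app; apply H1 in Hx; destruct Hx as [[Hx _]|([a n] & Hd & Hx)].
    + left; apply Hl, Hx.
    + right; apply fv_occurs in Hx; apply (HM a n); [|exact Hx].
      apply NNPP; intros Hn; apply Hd; simpl; rewrite Hl' by exact Hn; apply conv_refl.
  - intros b n Hb y Hy; simpl in Hb; apply H1.
    destruct (excluded_middle_informative (sdom th (b, n))) as [Hd|Hd].
    + right; exists (b, n); auto.
    + left; apply NNPP in Hd; apply (fv_conv Hd), fv_occurs in Hy; simpl in Hy; subst.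
      split; [exact Hb|]; intros K; exact (K Hd).
  - revert H2; apply Forall2_impl_in; auto using csapp_gcs.
Qed.

Lemma seq_instance_exists th Sig Ga C : exists q : sequent sg, seq_instance th Sig Ga C q.
Proof.
  assert (H : exists Hs, Forall2 (csapp th) Ga Hs).
  { induction Ga as [|B Ga [Hs IH]]; [exists []; constructor|].
    destruct (csapp_total th B) as [X HX]; exists (X :: Hs); constructor; assumption. }
  destruct H as [Hs HHs], (csapp_total th C) as [D HD].
  exists (Seq (ctx_sub Sig th) Hs D); split; [simpl; tauto|split; assumption].
Qed.

(** The rule takes one chosen instance per solution, while the hypothesis covers every instance, so
    the choice made in [F] does not matter. *)
Lemma derivable_nabsL defs Sig Ga C l b (s : tm [] (arrows l b)) (t : tm [] b) :
  sequent_ok (Seq Sig (nabs s t :: Ga) C) ->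
  (forall th (q : sequent sg), solution s t th -> seq_instance th Sig Ga C q -> sequent_ok q ->
     derivable (logic_with defs (@nabsL sg)) q) ->
  derivable (logic_with defs (@nabsL sg)) (Seq Sig (nabs s t :: Ga) C).
Proof.
  intros Hok H.
  pose (F := fun th => proj1_sig (constructive_indefinite_description _
                                    (seq_instance_exists th Sig Ga C))).
  assert (HF : forall th, seq_instance th Sig Ga C (F th))
    by (intros th; apply (proj2_sig (constructive_indefinite_description _ _))).
  assert (Hok' : sequent_ok (Seq Sig Ga C)).
  { destruct Hok as (H1 & H2 & H3); split; [exact H1|split; [|exact H3]].
    intros B HB; apply (H2 B); right; exact HB. }
  apply (derivable_rule (P := fun r => exists th, solution s t th /\ r = F th)); [|exact Hok|].
  - right; apply NabsLeft; [tauto|]; intros; apply HF.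
  - intros q (th & Hth & ->); apply (H th); [exact Hth|apply HF|].
    apply (seq_instance_ok Hok' (HF th)).
Qed.

(** * The identity substitution, confinement to a signature, and fresh choices *)

Lemma sid_fin : exists l : list var, forall a n, ~ In (a, n) l -> TVar [] a n = TVar [] a n.
Proof. exists []; reflexivity. Qed.

Definition sid : subst sg := Subst sid_fin.

Lemma sapp_id G a (t : tm G a) : sapp sid t = t.
Proof.
  induction t; simpl; try reflexivity; [rewrite IHt1, IHt2|rewrite IHt]; reflexivity.
Qed.

Lemma ssupp_id c : ~ ssupp sid c.
Proof. intros (a & n & H); apply supp_occurs in H; exact H. Qed.

Lemma gcs_id G a (B X : tm G a) : approx X B -> gcs sid B X.
Proof.
  intros H; exists pid; split; [intros c _; apply ssupp_id|].
  rewrite sapp_id, pact_id; exact H.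
Qed.

(* Variables outside [Sig'] are sent to nominal constants, which exist at every
   type. *)
Lemma confine_range th (Sig Sig' : ctx sg) :
  (exists l : list var, forall x, Sig x -> In x l) ->
  exists th', maps_ctx th' Sig Sig' /\
    forall B X : form sg, gcs th B X -> (forall x, fv X x -> Sig' x) -> gcs th' B X.
Proof.
  intros [l Hl]; destruct (occ_subst_finite true th l) as [M HM].
  (* The list [M] covers the variables in the terms assigned to [Sig], so the correction moves
     finitely many variables. The index [0] is arbitrary: capture is excluded below by a permutation
     that also avoids the new support. *)
  pose (f := fun (a : oty) (n : nat) =>
    if excluded_middle_informative (~ Sig' (a, n) /\ In (a, n) M)
    then TNom [] a 0 else TVar [] a n).
  assert (Hf : exists l : list var, forall a n, ~ In (a, n) l -> f a n = TVar [] a n).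
  { exists M; intros a n Hn; unfold f; destruct (excluded_middle_informative _); tauto. }
  exists (scomp th (Subst Hf)); split.
  - intros b n Hb y Hy; simpl in Hy; apply fv_sapp in Hy; destruct Hy as (b' & n' & H1 & H2).
    apply fv_occurs in H1; apply (HM b n (Hl _ Hb)) in H1.
    apply fv_occurs in H2; simpl in H2; unfold f in H2.
    destruct (excluded_middle_informative _) as [e|e]; [contradiction|].
    simpl in H2; subst; apply NNPP; tauto.
  - intros B X HX Hfv; destruct (occ_list false B) as [L HL].
    destruct (fresh_perm_exists L (finite_or (ssupp_finite th)
       (ssupp_finite (scomp th (Subst Hf))))) as [p Hp].
    assert (H1 : avoids p B th) by (apply occ_avoids; intros c Hc Hs; apply (Hp c); auto).
    exists p; split; [apply occ_avoids; intros c Hc Hs; apply (Hp c); auto|].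
    apply (gcs_any HX) in H1; eapply approx_trans; [exact H1|]; apply approx_conv.
    rewrite sapp_scomp; rewrite <- (sapp_id (sapp th (pact p B))) at 1.
    apply sapp_conv_fv; intros b n Hb; simpl; unfold f.
    destruct (excluded_middle_informative _) as [e|e]; [|apply conv_refl].
    (* All free variables of [X] are in [Sig'], where the correction is the identity. *)
    exfalso; apply e, Hfv, (fv_approx (approx_sym H1)), Hb.
Qed.

Lemma gcs_intro th p G a (B : tm G a) :
  (forall c, occurs_nom c B -> ~ ssupp th (pnom p c)) -> gcs th B (sapp th (pact p B)).
Proof. intros H; exists p; split; [apply occ_avoids, H|apply approx_refl]. Qed.

Lemma gcs_elim th p G a (B X : tm G a) : gcs th B X ->
  (forall c, occurs_nom c B -> ~ ssupp th (pnom p c)) -> approx X (sapp th (pact p B)).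
Proof. intros HX H; apply (gcs_any HX), occ_avoids, H. Qed.

Lemma fresh_perm_for2 th G G' a b (t : tm G a) (u : tm G' b) :
  exists p, (forall c, occurs_nom c t -> ~ ssupp th (pnom p c)) /\
            (forall c, occurs_nom c u -> ~ ssupp th (pnom p c)).
Proof.
  destruct (occ_list false t) as [L HL], (occ_list false u) as [L' HL'].
  destruct (fresh_perm_exists (L ++ L') (ssupp_finite th)) as [p Hp].
  exists p; split; intros c Hc; apply Hp, in_or_app; auto.
Qed.

Lemma fresh_perm_for th G a (t : tm G a) :
  exists p, forall c, occurs_nom c t -> ~ ssupp th (pnom p c).
Proof. destruct (fresh_perm_for2 th t t) as (p & Hp & _); exists p; exact Hp. Qed.

Lemma pact_closed p G a (t : tm G a) : (forall c, ~ occurs_nom c t) -> pact p t = t.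
Proof.
  induction t; simpl; intros H; try reflexivity.
  - destruct (H (a, n) eq_refl).
  - rewrite IHt1, IHt2; [reflexivity| |]; intros c Hc; apply (H c); auto.
  - rewrite IHt; [reflexivity|]; exact H.
Qed.

Lemma sapp_closed th G a (t : tm G a) : (forall x, ~ occurs_var x t) -> sapp th t = t.
Proof.
  induction t; simpl; intros H; try reflexivity.
  - destruct (H (a, n) eq_refl).
  - rewrite IHt1, IHt2; [reflexivity| |]; intros c Hc; apply (H c); auto.
  - rewrite IHt; [reflexivity|]; exact H.
Qed.

Lemma occurs_inst c G a b (t : tm (a :: G) b) (u : tm G a) :
  occurs_nom c (inst t u) -> occurs_nom c t \/ occurs_nom c u.
Proof.
  rewrite inst_as_gs; intros H; apply (@occ_gs false) in H.
  destruct H as [(d & m & H)|(k & d & n & H & H')].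
  - right; revert d m H.
    refine (@mem_cons_ind a G (fun d m => occ false c (scons u (@idb G) m) -> _) _ _); auto.
    intros d m H; contradiction.
  - left; apply occ_nm in H'; destruct H' as [<- ->]; exact H.
Qed.

Lemma inst_conv G a b (t t' : tm (a :: G) b) (u u' : tm G a) :
  conv t t' -> conv u u' -> conv (inst t u) (inst t' u').
Proof.
  intros Ht Hu; rewrite !inst_as_gs; eapply conv_trans; [apply gs_conv, Ht|].
  apply gs_conv_ext; [|intros; apply conv_refl].
  apply mem_cons_ind; [exact Hu|intros; apply conv_refl].
Qed.

Lemma lists_supp_exists G a (t : tm G a) : exists cs, lists_supp t cs.
Proof.
  destruct (occ_list false t) as [L HL].
  exists (nodup (fun c d => excluded_middle_informative (c = d)) (filter (fun c =>
    if excluded_middle_informative (supp t c) then true else false) L)).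
  split; [apply NoDup_nodup|]; intros c; rewrite nodup_In, filter_In.
  destruct (excluded_middle_informative (supp t c)) as [H|H]; split; intros H'; try tauto.
  - split; [apply HL, supp_occurs, H|reflexivity].
  - destruct H'; discriminate.
Qed.

Lemma ctx_fresh (Sig : ctx sg) (a : oty) :
  (exists l : list var, forall x, Sig x -> In x l) -> exists n, ~ Sig (a, n).
Proof.
  intros [l Hl]; destruct (index_bound (map (fun x => (true, x)) l)) as [N HN].
  exists N; intros H; apply Hl, (in_map (fun x => (true, x))), HN in H; lia.
Qed.

(* The fresh variable [h cs] of a raised quantifier is instantiated by
   [h' cs'], where [cs'] is the support of the instantiated body. *)
Lemma raise_instance th (Sig Sig' : ctx sg) (a : oty) (B : tm [oty_ty a] O) cs n p :
  lists_supp B cs -> ~ Sig (raised cs a, n) -> (forall x, fv B x -> Sig x) ->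
  (exists l : list var, forall x, Sig' x -> In x l) -> maps_ctx th Sig Sig' ->
  (forall c, occurs_nom c B -> ~ ssupp th (pnom p c)) ->
  exists cs' n' th',
    lists_supp (sapp th (pact p B)) cs' /\ ~ Sig' (raised cs' a, n') /\
    maps_ctx th' (ext Sig (raised cs a, n)) (ext Sig' (raised cs' a, n')) /\
    (forall D X : form sg, (forall x, fv D x -> Sig x) -> gcs th D X -> gcs th' D X) /\
    gcs th' (inst B (raise cs a n)) (inst (sapp th (pact p B)) (raise cs' a n')).
Proof.
  intros [Hnd Hcs] Hn HB Hfin Hm Hp.
  destruct (lists_supp_exists (sapp th (pact p B))) as [cs' Hcs'].
  destruct (ctx_fresh (raised cs' a) Hfin) as [n' Hn'].
  (* Under [p] and [th'], the raised variable applied to [cs] becomes [T] applied to the permuted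
     [cs]; beta turns this into [pact p u], which is the new raised variable applied to [cs']. *)
  pose (u := pact (pinverse p) (raise cs' a n')).
  pose (T := pact p (nlams cs u) : tm [] (raised cs a)).
  pose (th' := update th (h := (raised cs a, n)) T).
  assert (Hsame : th' (raised cs a) n = T) by apply update_same.
  assert (Hother : forall b m, Sig (b, m) -> th' b m = th b m).
  { intros b m H; apply update_other; intros e; apply Hn; rewrite e; exact H. }
  (* A constant of [cs'] comes from the body, and is then abstracted in [T], or from [th]. Hence
     [th'] brings in no constant beyond those of [th], and [p] can be kept. *)
  assert (HT : forall k x, occ k x T ->
    (k, x) = (true, (raised cs' a, n')) \/ k = false /\ ssupp th x).
  { intros [] x Hx.
    - left; assert (H1 : occurs_var x u).
      { assert (H2 : occurs_var x (nlams cs u)) by (revert Hx; apply occurs_var_pact).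
        apply (@occ_nlams true) in H2; apply H2. }
      apply occurs_var_pact in H1.
      apply (@occ_raise true) in H1; destruct H1 as [H1|[H1 _]]; [exact H1|discriminate].
    - right; split; [reflexivity|]; apply occurs_pact in Hx.
      apply (@occ_nlams false) in Hx; destruct Hx as [H1 H2]; specialize (H2 eq_refl).
      apply occurs_pact in H1.
      change (occ false (pnom p (pnom (pinverse p) x)) (raise cs' a n')) in H1.
      rewrite pnom_invr in H1; apply occ_raise in H1; destruct H1 as [H3|[_ H3]]; [discriminate|].
      apply Hcs', supp_sapp in H3; destruct H3 as [H3|H3]; [|exact H3].
      apply supp_pact in H3; destruct H3 as (d & H3 & ->).
      rewrite pnom_inv in H2; destruct H2; apply Hcs, H3. }
  assert (Hsup : forall c, ssupp th' c -> ssupp th c).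
  { intros c (b & m & Hc).
    destruct (excluded_middle_informative ((raised cs a, n) = (b, m))) as [e|e].
    - inversion e; subst b m; rewrite Hsame in Hc; apply supp_occurs, (HT false) in Hc.
      destruct Hc as [Hc|[_ Hc]]; [discriminate|exact Hc].
    - unfold th' in Hc; rewrite update_other in Hc by exact e; exists b, m; exact Hc. }
  exists cs', n', th'; split; [exact Hcs'|split; [exact Hn'|split; [|split]]].
  - intros b m [Hb|Hb] y Hy.
    + left; rewrite (Hother _ _ Hb) in Hy; exact (Hm _ _ Hb _ Hy).
    + inversion Hb; subst b m; rewrite Hsame in Hy; apply fv_occurs, (HT true) in Hy.
      destruct Hy as [Hy|[Hy _]]; [right; injection Hy; auto|discriminate].
  - intros D X HD; apply gcs_agree; intros b m Hb; rewrite Hother by (apply HD, Hb).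
    apply conv_refl.
  - exists p; split.
    + apply occ_avoids; intros c Hc Hs; apply Hsup in Hs; revert Hs; apply Hp.
      apply occurs_inst in Hc; destruct Hc as [Hc|Hc]; [exact Hc|].
      apply (@occ_raise false) in Hc; destruct Hc as [Hc|[_ Hc]]; [discriminate|].
      apply supp_occurs, Hcs, Hc.
    + rewrite pact_inst, sapp_inst; apply approx_conv, inst_conv.
      * apply sapp_conv_fv; intros b m Hb; rewrite Hother; [apply conv_refl|].
        apply HB; eapply fv_pact, Hb.
      * unfold raise at 2; rewrite pact_apps, sapp_apps, sapp_pact_nom_args.
        change (sapp th' (pact p (TVar [] (raised cs a) n)))
          with (wk0 [] (th' (raised cs a) n)).
        rewrite wk0_nil, Hsame; unfold T.
        rewrite <- pact_apps.
        eapply conv_trans; [|apply pact_conv, conv_sym, apps_nlams].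
        unfold u; rewrite pact_invr; apply conv_refl.
Qed.

(** * Derivability is closed under substitution *)

(** The target signature is not computed from [th], so the property includes weakening and
    strengthening of signatures as well as free choice of the values of instances. *)
Definition substitutive defs (q : sequent sg) : Prop :=
  forall th Sig Hs C, sequent_ok (Seq Sig Hs C) ->
    Forall2 (@gcs th [] O) (hyps q) Hs -> gcs th (goal q) C ->
    derivable (logic_with defs (@nabsL sg)) (Seq Sig Hs C).

Lemma sapp_pact_atom th p (P : psym sg) (ts : args [] (tys (pargs P))) :
  sapp th (pact p (atom ts)) =
  atom (map_args (sapp th (G := [])) (map_args (pact p (G := [])) ts)).
Proof. unfold atom; rewrite pact_apps, sapp_apps; reflexivity. Qed.

Lemma sapp_pact_apps_closed th p l b (S : tm [] (arrows l b)) (ts : args [] l) :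
  (forall c, ~ occurs_nom c S) -> (forall x, ~ occurs_var x S) ->
  sapp th (pact p (apps S ts)) =
  apps S (map_args (sapp th (G := [])) (map_args (pact p (G := [])) ts)).
Proof.
  intros H1 H2; rewrite pact_apps, sapp_apps, (pact_closed p H1), (sapp_closed th H2).
  reflexivity.
Qed.

(** A clause body contains no names, so instantiation reaches only the arguments. *)
Lemma sapp_pact_unfold_body th p defs d S (ts : args [] (tys (pargs (cl_pred d)))) :
  definition_ok defs -> In d defs ->
  (forall c, ~ occurs_nom c S) -> (forall x, ~ occurs_var x S) ->
  sapp th (pact p (unfold_body S ts)) =
  unfold_body S (map_args (sapp th (G := [])) (map_args (pact p (G := [])) ts)).
Proof.
  intros Hd Hin H1 H2; apply sapp_pact_apps_closed.
  - intros c [H|H]; [exact (def_nom Hd Hin H)|exact (H1 c H)].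
  - intros c [H|H]; [exact (def_var Hd Hin H)|exact (H2 c H)].
Qed.

Local Ltac premise_instance H r :=
    apply (H r); [first [left; reflexivity|right; left; reflexivity]|simpl; tauto
                 |simpl; try assumption|simpl; try assumption].

(** Derivability of the premises is kept beside the induction hypothesis: it gives their
    well-formedness, and the closed premises of induction and co-induction are reused unchanged. *)
Lemma substitutive_core defs (P : sequent sg -> Prop) (q : sequent sg) :
  definition_ok defs -> core defs P q -> sequent_ok q ->
  (forall r, P r -> derivable (logic_with defs (@nabsL sg)) r) ->
  (forall r, P r -> substitutive defs r) ->
  forall th Sig' Hs' C', maps_ctx th (sctx q) Sig' -> sequent_ok (Seq Sig' Hs' C') ->
    Forall2 (@gcs th [] O) (hyps q) Hs' -> gcs th (goal q) C' ->
    derivable (logic_with defs (@nabsL sg)) (Seq Sig' Hs' C').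
Proof.
  intros Hd HR Hok HP IH th Sig' Hs' C' Hm Hok' HH HC.
  (* Premises over no larger signature keep [th]; the rules with a new eigenvariable replace it
     through [raise_instance]. *)
  assert (IHw : forall r, P r -> (forall x, sctx r x -> sctx q x) ->
    forall Hs C, Forall2 (@gcs th [] O) (hyps r) Hs -> gcs th (goal r) C ->
    derivable (logic_with defs (@nabsL sg)) (Seq Sig' Hs C)).
  { intros r Hr Hsub Hs C H1 H2; apply (IH r Hr th); auto.
    apply (sequent_ok_gcs (derivable_ok (HP r Hr)) (th := th)); auto.
    - apply Hok'.
    - intros b n Hb; apply Hm, Hsub, Hb. }
  destruct HR; simpl in *.
  - inversion HH as [|? X ? Ga' HX HG]; subst.
    apply (derivable_core (r_id defs Sig' Ga' (B := X) (B' := C')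
             (gcs_unique (gcs_approx_l HX H) HC)) Hok'); simpl; tauto.
  - apply Forall2_app_inv_l in HH; destruct HH as (H1 & H2 & K1 & K2 & ->).
    (* The conclusion prescribes no instance of the cut formula; any value will do, and [maps_ctx]
       keeps its free variables in [Sig']. *)
    destruct (gcs_total th B) as [D HD].
    apply (derivable_core (r_cut defs Sig' H1 H2 D C') Hok').
    intros r [<-|[<-|[]]].
    + premise_instance IHw (Seq Sig Ga B).
    + premise_instance IHw (Seq Sig (B :: De) C); auto.
  - inversion HH as [|? X ? Ga' HX HG]; subst.
    apply (derivable_core (r_contr defs Sig' Ga' X C') Hok').
    intros r [<-|[]]; premise_instance IHw (Seq Sig (B :: B :: Ga) C); auto.
  - inversion HH as [|? X ? Ga' (p & _ & Ha) HG]; subst.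
    apply (derivable_core_left (r_botL defs Sig' Ga' C') Ha Hok'); simpl; tauto.
  - destruct HC as (p & _ & Ha).
    apply (derivable_core_right (r_topR defs Sig' Hs') Ha Hok'); simpl; tauto.
  - inversion HH as [|? X ? Ga' HX HG]; subst.
    destruct (fresh_perm_for th (disj B D)) as [p Hp].
    apply (derivable_core_left (r_disjL defs Sig' Ga' (sapp th (pact p B))
             (sapp th (pact p D)) C') (gcs_elim HX Hp) Hok').
    intros r [<-|[<-|[]]].
    + premise_instance IHw (Seq Sig (B :: Ga) C).
      constructor; [|exact HG]; apply gcs_intro; intros c Hc; apply Hp; simpl; auto.
    + premise_instance IHw (Seq Sig (D :: Ga) C).
      constructor; [|exact HG]; apply gcs_intro; intros c Hc; apply Hp; simpl; auto.
  - destruct (fresh_perm_for th (disj B D)) as [p Hp].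
    apply (derivable_core_right (r_disjR1 defs Sig' Hs' (sapp th (pact p B))
             (sapp th (pact p D))) (gcs_elim HC Hp) Hok').
    intros r [<-|[]]; premise_instance IHw (Seq Sig Ga B).
    apply gcs_intro; intros c Hc; apply Hp; simpl; auto.
  - destruct (fresh_perm_for th (disj B D)) as [p Hp].
    apply (derivable_core_right (r_disjR2 defs Sig' Hs' (sapp th (pact p B))
             (sapp th (pact p D))) (gcs_elim HC Hp) Hok').
    intros r [<-|[]]; premise_instance IHw (Seq Sig Ga D).
    apply gcs_intro; intros c Hc; apply Hp; simpl; auto.
  - inversion HH as [|? X ? Ga' HX HG]; subst.
    destruct (fresh_perm_for th (conj B D)) as [p Hp].
    apply (derivable_core_left (r_conjL1 defs Sig' Ga' (sapp th (pact p B))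
             (sapp th (pact p D)) C') (gcs_elim HX Hp) Hok').
    intros r [<-|[]]; premise_instance IHw (Seq Sig (B :: Ga) C).
    constructor; [|exact HG]; apply gcs_intro; intros c Hc; apply Hp; simpl; auto.
  - inversion HH as [|? X ? Ga' HX HG]; subst.
    destruct (fresh_perm_for th (conj B D)) as [p Hp].
    apply (derivable_core_left (r_conjL2 defs Sig' Ga' (sapp th (pact p B))
             (sapp th (pact p D)) C') (gcs_elim HX Hp) Hok').
    intros r [<-|[]]; premise_instance IHw (Seq Sig (D :: Ga) C).
    constructor; [|exact HG]; apply gcs_intro; intros c Hc; apply Hp; simpl; auto.
  - destruct (fresh_perm_for th (conj B C)) as [p Hp].
    apply (derivable_core_right (r_conjR defs Sig' Hs' (sapp th (pact p B))
             (sapp th (pact p C))) (gcs_elim HC Hp) Hok').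
    intros r [<-|[<-|[]]].
    + premise_instance IHw (Seq Sig Ga B).
      apply gcs_intro; intros c Hc; apply Hp; simpl; auto.
    + premise_instance IHw (Seq Sig Ga C).
      apply gcs_intro; intros c Hc; apply Hp; simpl; auto.
  - inversion HH as [|? X ? Ga' HX HG]; subst.
    destruct (fresh_perm_for th (imp B D)) as [p Hp].
    apply (derivable_core_left (r_impL defs Sig' Ga' (sapp th (pact p B))
             (sapp th (pact p D)) C') (gcs_elim HX Hp) Hok').
    intros r [<-|[<-|[]]].
    + premise_instance IHw (Seq Sig Ga B).
      apply gcs_intro; intros c Hc; apply Hp; simpl; auto.
    + premise_instance IHw (Seq Sig (D :: Ga) C).
      constructor; [|exact HG]; apply gcs_intro; intros c Hc; apply Hp; simpl; auto.
  - destruct (fresh_perm_for th (imp B C)) as [p Hp].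
    apply (derivable_core_right (r_impR defs Sig' Hs' (sapp th (pact p B))
             (sapp th (pact p C))) (gcs_elim HC Hp) Hok').
    intros r [<-|[]]; premise_instance IHw (Seq Sig (B :: Ga) C).
    + constructor; [|exact HH]; apply gcs_intro; intros c Hc; apply Hp; simpl; auto.
    + apply gcs_intro; intros c Hc; apply Hp; simpl; auto.
  - inversion HH as [|? X ? Ga' HX HG]; subst.
    (* One permutation serves the body and the witness, so that their instances combine into an
       instance of the premise. *)
    destruct (fresh_perm_for2 th (all B) t) as (p & Hp & Hp').
    assert (Ht : forall x, fv (sapp th (pact p t)) x -> Sig' x).
    { intros x Hx; apply fv_sapp in Hx; destruct Hx as (b & n & H1 & H2).
      apply (Hm b n); [eapply H, fv_pact, H1|exact H2]. }
    apply (derivable_core_left (r_allL defs Ga' (sapp th (pact p B)) C' Ht)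
             (gcs_elim HX Hp) Hok').
    intros r [<-|[]]; premise_instance IHw (Seq Sig (inst B t :: Ga) C).
    constructor; [|exact HG]; rewrite <- sapp_inst, <- pact_inst; apply gcs_intro.
    intros c Hc; apply occurs_inst in Hc; destruct Hc; [apply Hp; simpl; auto|auto].
  - destruct (fresh_perm_for th (all B)) as [p Hp].
    destruct (@raise_instance th Sig Sig' a B cs n p) as
      (cs' & n' & th' & K1 & K2 & K3 & K4 & K5); auto.
    { intros x Hx; apply (proj2 (proj2 Hok)), fv_quantified, Hx. }
    { apply Hok'. }
    { intros c Hc; apply Hp; simpl; auto. }
    apply (derivable_core_right (r_allR defs Hs' K1 K2) (gcs_elim HC Hp) Hok').
    assert (Hpr : prem [Seq (ext Sig (raised cs a, n)) Ga (inst B (raise cs a n))]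
                    (Seq (ext Sig (raised cs a, n)) Ga (inst B (raise cs a n))))
      by (left; reflexivity).
    assert (HH' : Forall2 (@gcs th' [] O) Ga Hs').
    { revert HH; apply Forall2_impl_in; intros D X HD _; apply K4, Hok, HD. }
    intros r [<-|[]]; apply (IH _ Hpr th'); simpl; auto.
    apply (sequent_ok_gcs (derivable_ok (HP _ Hpr)) (th := th')); simpl; auto.
    destruct Hok' as ((l & Hl) & _); exists ((raised cs' a, n') :: l).
    intros x [Hx| ->]; [right; apply Hl, Hx|left; reflexivity].
  - inversion HH as [|? X ? Ga' HX HG]; subst.
    destruct (fresh_perm_for th (ex B)) as [p Hp].
    destruct (@raise_instance th Sig Sig' a B cs n p) as
      (cs' & n' & th' & K1 & K2 & K3 & K4 & K5); auto.
    { intros x Hx; apply (proj1 (proj2 Hok) (ex B)); [left; reflexivity|].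
      apply fv_quantified, Hx. }
    { apply Hok'. }
    { intros c Hc; apply Hp; simpl; auto. }
    apply (derivable_core_left (r_exL defs Ga' C' K1 K2) (gcs_elim HX Hp) Hok').
    assert (Hpr : prem [Seq (ext Sig (raised cs a, n)) (inst B (raise cs a n) :: Ga) C]
                    (Seq (ext Sig (raised cs a, n)) (inst B (raise cs a n) :: Ga) C))
      by (left; reflexivity).
    assert (HH' : Forall2 (@gcs th' [] O) (inst B (raise cs a n) :: Ga)
                    (inst (sapp th (pact p B)) (raise cs' a n') :: Ga')).
    { constructor; [exact K5|]; revert HG; apply Forall2_impl_in.
      intros D Y HD _; apply K4, Hok; right; exact HD. }
    assert (HC' : gcs th' C C') by (apply K4; [apply Hok|exact HC]).
    intros r [<-|[]]; apply (IH _ Hpr th'); simpl; auto.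
    apply (sequent_ok_gcs (derivable_ok (HP _ Hpr)) (th := th')); simpl; auto.
    destruct Hok' as ((l & Hl) & _); exists ((raised cs' a, n') :: l).
    intros x [Hx| ->]; [right; apply Hl, Hx|left; reflexivity].
  - destruct (fresh_perm_for2 th (ex B) t) as (p & Hp & Hp').
    assert (Ht : forall x, fv (sapp th (pact p t)) x -> Sig' x).
    { intros x Hx; apply fv_sapp in Hx; destruct Hx as (b & n & H1 & H2).
      apply (Hm b n); [eapply H, fv_pact, H1|exact H2]. }
    apply (derivable_core_right (r_exR defs Hs' (sapp th (pact p B)) Ht)
             (gcs_elim HC Hp) Hok').
    intros r [<-|[]]; premise_instance IHw (Seq Sig Ga (inst B t)).
    rewrite <- sapp_inst, <- pact_inst; apply gcs_intro.
    intros c Hc; apply occurs_inst in Hc; destruct Hc; [apply Hp; simpl; auto|auto].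
  - inversion HH as [|? X ? Ga' HX HG]; subst.
    (* Here [p] also sends [(a, n)] outside the support of [th], hence its image is fresh for the
       instantiated body. *)
    destruct (fresh_perm_for2 th (nabla B) (TNom [] a n)) as (p & Hp & Hp').
    assert (Hn : ~ supp (sapp th (pact p B)) (a, pfun p a n)).
    { intros Hs; apply supp_sapp in Hs; destruct Hs as [Hs|Hs]; [|exact (Hp' _ eq_refl Hs)].
      apply supp_pact in Hs; destruct Hs as (d & Hs & e).
      apply (@pnom_inj p (a, n)) in e; subst; exact (H Hs). }
    apply (derivable_core_left (r_nablaL defs Sig' Ga' C' Hn) (gcs_elim HX Hp) Hok').
    intros r [<-|[]]; premise_instance IHw (Seq Sig (inst B (TNom [] a n) :: Ga) C).
    constructor; [|exact HG].
    change (TNom [] a (pfun p a n)) with (sapp th (pact p (TNom [] a n))).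
    rewrite <- sapp_inst, <- pact_inst; apply gcs_intro.
    intros c Hc; apply occurs_inst in Hc; destruct Hc; [apply Hp; simpl; auto|auto].
  - destruct (fresh_perm_for2 th (nabla B) (TNom [] a n)) as (p & Hp & Hp').
    assert (Hn : ~ supp (sapp th (pact p B)) (a, pfun p a n)).
    { intros Hs; apply supp_sapp in Hs; destruct Hs as [Hs|Hs]; [|exact (Hp' _ eq_refl Hs)].
      apply supp_pact in Hs; destruct Hs as (d & Hs & e).
      apply (@pnom_inj p (a, n)) in e; subst; exact (H Hs). }
    apply (derivable_core_right (r_nablaR defs Sig' Hs' Hn) (gcs_elim HC Hp) Hok').
    intros r [<-|[]]; premise_instance IHw (Seq Sig Ga (inst B (TNom [] a n))).
    change (TNom [] a (pfun p a n)) with (sapp th (pact p (TNom [] a n))).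
    rewrite <- sapp_inst, <- pact_inst; apply gcs_intro.
    intros c Hc; apply occurs_inst in Hc; destruct Hc; [apply Hp; simpl; auto|auto].
  - destruct (nabs_holds_by H) as [cs Hcs], (occ_list false (nabs s t)) as [L HL].
    (* The abstracted constants are moved too, so that [th] commutes with the abstractions over
       them. *)
    destruct (fresh_perm_exists (cs ++ L) (ssupp_finite th)) as [p Hp].
    assert (Hh : nabs_holds (sapp th (pact p s)) (sapp th (pact p t))).
    { eapply nabs_by_sapp, nabs_by_pact; [|exact Hcs].
      intros c Hc; apply Hp, in_or_app; auto. }
    assert (Ha : approx C' (sapp th (pact p (nabs s t)))).
    { apply (gcs_elim HC); intros c Hc; apply Hp, in_or_app; right; apply HL, Hc. }
    apply (derivable_core_right (r_nabsR defs Sig' Hs' Hh) Ha Hok'); simpl; tauto.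
  - inversion HH as [|? X ? Ga' HX HG]; subst.
    destruct (fresh_perm_for2 th (atom ts) (unfold_body (TPred [] (cl_pred d)) ts))
      as (p & Hp & Hp').
    apply (gcs_elim HX) in Hp; rewrite sapp_pact_atom in Hp.
    apply (derivable_core_left (r_defL Sig' Ga' _ C' H) Hp Hok').
    intros r [<-|[]]; eapply IHw; [left; reflexivity|simpl; auto| |exact HC].
    constructor; [|exact HG].
    rewrite <- (sapp_pact_unfold_body (S := TPred [] (cl_pred d)) th p ts Hd H) by (simpl; tauto).
    apply gcs_intro, Hp'.
  - destruct (fresh_perm_for2 th (atom ts) (unfold_body (TPred [] (cl_pred d)) ts))
      as (p & Hp & Hp').
    apply (gcs_elim HC) in Hp; rewrite sapp_pact_atom in Hp.
    apply (derivable_core_right (r_defR Sig' Hs' _ H) Hp Hok').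
    intros r [<-|[]]; eapply IHw; [left; reflexivity|simpl; auto|exact HH|].
    simpl; rewrite <- (sapp_pact_unfold_body (S := TPred [] (cl_pred d)) th p ts Hd H) by (simpl; tauto).
    apply gcs_intro, Hp'.
  - inversion HH as [|? X ? Ga' HX HG]; subst.
    destruct (fresh_perm_for2 th (atom ts) (apps S ts)) as (p & Hp & Hp').
    apply (gcs_elim HX) in Hp; rewrite sapp_pact_atom in Hp.
    apply (derivable_core_left (r_ind Sig' Ga' _ C' H H0 H1 H2 H3 H4) Hp Hok').
    intros r [<-|[<-|[]]]; [apply HP; left; reflexivity|].
    eapply IHw; [right; left; reflexivity|simpl; auto| |exact HC].
    constructor; [|exact HG].
    rewrite <- (sapp_pact_apps_closed th p ts H1 H2); apply gcs_intro, Hp'.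
  - destruct (fresh_perm_for2 th (atom ts) (apps S ts)) as (p & Hp & Hp').
    apply (gcs_elim HC) in Hp; rewrite sapp_pact_atom in Hp.
    apply (derivable_core_right (r_coind Sig' Hs' _ H H0 H1 H2 H3 H4) Hp Hok').
    intros r [<-|[<-|[]]]; [|apply HP; right; left; reflexivity].
    eapply IHw; [left; reflexivity|simpl; auto|exact HH|].
    simpl; rewrite <- (sapp_pact_apps_closed th p ts H1 H2); apply gcs_intro, Hp'.
Qed.

Lemma sbullet_exists th rho : exists ta, sbullet th rho ta.
Proof.
  destruct (ssupp_finite th) as [M HM].
  destruct (fresh_perm_exists M (ssupp_finite rho)) as [p Hp].
  exists (scomp (spact p th) rho), p; split; [|intros a n; apply conv_refl].
  intros c [(a & n & H) Hc]; simpl in H; apply supp_pact in H; destruct H as (d & H & ->).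
  apply (Hp d); [|exact Hc]; apply HM; exists a, n; exact H.
Qed.

(** Two values of one instance are related by [approx], which is instantiation by [sid]; closure
    under [sid] thus passes from one choice of values to another. *)
Lemma Forall2_gcs_id th (Ga Ys Xs : list (form sg)) :
  Forall2 (csapp th) Ga Ys -> Forall2 (@gcs th [] O) Ga Xs -> Forall2 (@gcs sid [] O) Ys Xs.
Proof.
  intros H; revert Xs; induction H as [|B Y Ga Ys HY _ IH]; intros Xs K;
    inversion K; subst; constructor; auto.
  apply gcs_id, (gcs_unique (th := th) (B := B)); [assumption|apply csapp_gcs, HY].
Qed.

Lemma Forall2_gcs_bullet th rho ta (Ga Xs Ys : list (form sg)) :
  sbullet th rho ta -> Forall2 (@gcs th [] O) Ga Xs -> Forall2 (csapp rho) Xs Ys ->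
  Forall2 (@gcs ta [] O) Ga Ys.
Proof.
  intros Hb H; revert Ys; induction H as [|B X Ga Xs HX _ IH]; intros Ys K;
    inversion K; subst; constructor; auto.
  eapply gcs_bullet; [exact Hb|exact HX|apply csapp_gcs; assumption].
Qed.

Lemma derivable_substitutive defs (q : sequent sg) : definition_ok defs ->
  derivable (logic_with defs (@nabsL sg)) q -> substitutive defs q.
Proof.
  intros Hd H; induction H as [P q q' HR Heq Hok HP IH].
  intros th0 Sig' Hs0 C' Hok0 HH0 HC0.
  assert (Hokq : sequent_ok q) by (apply (sequent_ok_seq_eq Heq Hok)).
  assert (HC1 : gcs th0 (goal q) C').
  { apply (gcs_approx_l HC0), approx_conv, conv_sym, Heq. }
  assert (HH1 : exists Hs, Permutation Hs Hs0 /\ Forall2 (@gcs th0 [] O) (hyps q) Hs).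
  { destruct Heq as (_ & (G & K1 & K2) & _).
    assert (K3 : Forall2 (@gcs th0 [] O) G Hs0).
    { clear - K2 HH0; revert Hs0 HH0; induction K2; intros Hs0 HH0; inversion HH0; subst;
        constructor; auto; eapply gcs_approx_l; [eassumption|]; apply approx_conv, conv_sym, H. }
    destruct (Permutation_Forall2 (Permutation_sym K1) K3) as (Hs & K4 & K5).
    exists Hs; split; [apply Permutation_sym, K4|exact K5]. }
  destruct HH1 as (Hs' & Hperm & HH1).
  assert (Heq' : seq_eq (Seq Sig' Hs' C') (Seq Sig' Hs0 C')).
  { split; [tauto|split; [|apply conv_refl]]; exists Hs0; split; [exact Hperm|].
    apply Forall2_conv_refl. }
  apply (derivable_seq_eq (q := Seq Sig' Hs' C')); [|exact Heq'|exact Hok0].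
  assert (Hok' : sequent_ok (Seq Sig' Hs' C')) by (apply (sequent_ok_seq_eq Heq' Hok0)).
  (* The given substitution may lead out of [Sig'] on eigenvariables that the conclusion does not
     mention but the premises use. *)
  destruct (confine_range th0 Sig' (proj1 Hokq)) as (th & Hm & Hth).
  assert (HC : gcs th (goal q) C') by (apply (Hth _ _ HC1), Hok').
  assert (HH : Forall2 (@gcs th [] O) (hyps q) Hs').
  { revert HH1; apply Forall2_impl_in; intros B X _ HX HB; apply (Hth _ _ HB), Hok', HX. }
  clear th0 Hs0 Hok0 HH0 HC0 HC1 HH1 Hperm Heq' Hth.
  destruct HR as [HR|HR]; [exact (substitutive_core Hd HR Hokq HP IH Hm Hok' HH HC)|].
  destruct HR as [Sig Ga C l b s t S F HS HF]; simpl in *.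
  inversion HH as [|? X ? Ga' HX HG]; subst.
  destruct (fresh_perm_for th (nabs s t)) as [p Hp].
  pose proof (gcs_elim HX Hp) as Ha.
  apply (derivable_approx_hyp Ha Hok').
  apply (sequent_ok_approx_hyp Ha) in Hok'.
  apply (derivable_nabsL (s := sapp th (pact p s)) (t := sapp th (pact p t))); [exact Hok'|].
  intros rho r Hrho (R1 & R2 & R3) Hr.
  destruct (sbullet_exists th rho) as [ta Hta].
  assert (Hsol : solution s t ta).
  { apply solution_gcs in Hrho; destruct Hrho as (s' & t' & K1 & K2).
    apply solution_gcs; exists s', t'; split; [|exact K2].
    eapply gcs_bullet; [exact Hta|apply (gcs_intro Hp)|exact K1]. }
  apply HS in Hsol; destruct (HF _ Hsol) as (F1 & F2 & F3).
  (* The premise at [ta] has the formulas of [r] up to [approx], possibly over another signature;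
     the induction hypothesis at [sid] bridges both differences. *)
  destruct r as [Sr Hr' Cr]; apply (IH (F ta)) with (th := sid); [eauto|exact Hr| |].
  - apply (Forall2_gcs_id F2), (Forall2_gcs_bullet Hta HG R2).
  - apply gcs_id, (gcs_unique (th := ta) (B := C)); [|apply csapp_gcs, F3].
    eapply gcs_bullet; [exact Hta|exact HC|apply csapp_gcs, R3].
Qed.

(** * Inter-admissibility *)

Lemma sle_refl th : sle th th.
Proof.
  exists sid, (scomp (spact pid th) sid); split.
  - exists pid; split; [intros c [_ H]; exact (ssupp_id H)|intros a n; apply conv_refl].
  - exists pid; intros a n; simpl; rewrite sapp_id, !pact_id; apply conv_refl.
Qed.

(** Each solution lies below itself, so an instance of [nabsL] is already an instance of
    [nabsL_csnas]. *)
Lemma solutions_complete Sig l b (s : tm [] (arrows l b)) (t : tm [] b) (S : subst sg -> Prop) :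
  (forall th, S th <-> solution s t th) -> complete_set Sig s t S.
Proof.
  intros H; split; [intros th; apply H|].
  intros rho Hrho; exists rho; split; [apply H, Hrho|apply sle_refl].
Qed.

Lemma gcs_restrict th (Sig : ctx sg) (B X : form sg) :
  (forall x, fv B x -> Sig x) -> gcs (srestr th Sig) B X <-> gcs th B X.
Proof.
  intros H; split; apply gcs_agree; intros b n Hb; simpl; unfold srestr_fun;
    (destruct (excluded_middle_informative _) as [e|e];
     [apply conv_refl|destruct e; apply H, Hb]).
Qed.

(** A single [sigma] serves all formulas of a sequent. Restricting to [Sig] is harmless for formulas
    with free variables in [Sig]. *)
Lemma gcs_sle th rho (Sig : ctx sg) : sle_on Sig rho th ->
  exists sigma, forall B X Y : form sg, (forall x, fv B x -> Sig x) ->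
    csapp th B Y -> csapp rho B X -> gcs sigma Y X.
Proof.
  intros (sigma & ta & Hta & Hap); exists sigma; intros B X Y HB HY HX.
  apply csapp_gcs in HX; apply csapp_gcs in HY.
  destruct (gcs_total sigma Y) as [Z HZ]; apply (gcs_approx_r HZ).
  apply (gcs_unique HX).
  apply (gcs_restrict (Sig := Sig) rho Z HB), (gcs_sapprox Hap).
  apply (gcs_bullet Hta (X := Y)); [|exact HZ].
  apply (gcs_restrict (Sig := Sig) th Y HB), HY.
Qed.

(** The premise at [rho] need not live over the image under [sigma] of the signature at [th]; that
    it is well formed is enough, because [substitutive] leaves the signature free. *)
Lemma complete_set_admissible defs Sig Ga C l b (s : tm [] (arrows l b)) (t : tm [] b)
    (S : subst sg -> Prop) (F : subst sg -> sequent sg) :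
  definition_ok defs -> complete_set Sig s t S ->
  (forall th, S th -> seq_instance th Sig Ga C (F th)) ->
  sequent_ok (Seq Sig (nabs s t :: Ga) C) ->
  (forall th, S th -> derivable (logic_with defs (@nabsL sg)) (F th)) ->
  derivable (logic_with defs (@nabsL sg)) (Seq Sig (nabs s t :: Ga) C).
Proof.
  intros Hd [_ HS] HF Hok HD; apply (derivable_nabsL Hok).
  intros rho [Sr Hr Cr] Hrho (_ & R2 & R3) Hokr.
  destruct (HS _ Hrho) as (th & Hth & Hle); destruct (gcs_sle Hle) as [sigma Hs].
  destruct (HF _ Hth) as (_ & F2 & F3); destruct Hok as (_ & H2 & H3); simpl in *.
  apply (derivable_substitutive Hd (HD _ Hth) (th := sigma)); [exact Hokr| |].
  - assert (H2' : forall B, In B Ga -> forall x, fv B x -> Sig x)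
      by (intros B HB; apply H2; right; exact HB).
    clear - Hs F2 R2 H2'; simpl; revert Hr R2.
    induction F2 as [|B Y Ga Ys HY _ IH]; intros Hr R2; inversion R2; subst; constructor.
    + apply (Hs B); [apply H2'; left; reflexivity| |]; assumption.
    + apply IH; [|assumption]; intros D HD'; apply H2'; right; exact HD'.
  - apply (Hs C); assumption.
Qed.

Lemma admissible_derivable defs (L L' : rule sg) :
  admissible L (logic_with defs L') ->
  forall q : sequent sg, derivable (logic_with defs L) q -> derivable (logic_with defs L') q.
Proof.
  intros HL q H; induction H as [P q q' HR Heq Hok HP IH].
  apply (derivable_seq_eq (q := q)); [|exact Heq|exact Hok].
  pose proof (sequent_ok_seq_eq Heq Hok) as Hokq.
  destruct HR as [HR|HR]; [|exact (HL _ _ HR Hokq IH)].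
  apply (derivable_rule (P := P)); [left; exact HR|exact Hokq|exact IH].
Qed.

Lemma inter_admissible_intro defs (L L' : rule sg) :
  admissible L (logic_with defs L') -> admissible L' (logic_with defs L) ->
  inter_admissible defs L L'.
Proof.
  intros H H'; split; [exact H|split; [exact H'|]].
  intros q; split; apply admissible_derivable; assumption.
Qed.

End Inter.

Theorem theorem1 (sg : signature) (defs : list (clause sg))
    (Hdefs : definition_ok defs) :
  inter_admissible defs (@nabsL sg) (@nabsL_csnas sg)
  /\ forall csnas : solution_sets sg,
       (forall Sig l b s t, complete_set Sig s t (csnas Sig l b s t)) ->
       inter_admissible defs (@nabsL sg) (nabsL_fixed csnas).
Proof.
  split; [|intros csnas Hc]; apply inter_admissible_intro; intros P q HR Hok HP.
  - destruct HR as [Sig Ga C l b s t S F HS HF].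
    apply (derivable_rule (P := fun r => exists th, S th /\ r = F th)); [|exact Hok|exact HP].
    right; apply NabsLeft; [apply solutions_complete, HS|exact HF].
  - destruct HR as [Sig Ga C l b s t S F HS HF].
    apply (complete_set_admissible Hdefs HS HF Hok); eauto.
  - destruct HR as [Sig Ga C l b s t S F HS HF].
    (* Members of the fixed set are solutions, so its premises are among those given. *)
    assert (Hsub : forall th, csnas Sig l b s t th -> S th)
      by (intros th Hth; apply HS, (Hc Sig l b s t), Hth).
    apply (derivable_rule (P := fun r => exists th, csnas Sig l b s t th /\ r = F th));
      [|exact Hok|intros r (th & Hth & ->); eauto].
    right; apply NabsLeft; [tauto|auto].
  - destruct HR as [Sig Ga C l b s t S F HS HF].
    apply (complete_set_admissible (S := csnas Sig l b s t) Hdefs (Hc _ _ _ _ _) (F := F));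
      [|exact Hok|]; intros th Hth; apply HS in Hth; eauto.
Qed.
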